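(* Suppose that $\iota\colon M\hookrightarrow M'$ is a closed embedding of complex manifolds. Let $\mathcal{A}$ be the sheaf of $\mathbb{C}$-algebras $\mathcal{A}=\iota^{-1}\mathcal{O}_{M'}$ over $M$ and let $\mathcal{B}$ be a coherent $\mathcal{A}$-module. Then: (i) There exist an open neighbourhood $N$ of $M$ in $M'$ and a coherent $\mathcal{O}_N$-module $\mathcal{B}'$ on $N$ such that $\iota^{-1}\mathcal{B}'\cong\mathcal{B}$ as sheaves of $\mathcal{A}$-modules. (ii) The sheaf-germ $\mathcal{B}'$ is unique up to unique isomorphism in the following sense. If $\mathcal{B}_1'$ and $\mathcal{B}_2'$ are two coherent $\mathcal{O}_N$-modules on an open neighbourhood $N$ of $M$ in $M'$, equipped with isomorphisms $\iota^{-1}\mathcal{B}_1'\cong\mathcal{B}\cong\iota^{-1}\mathcal{B}_2'$ of $\mathcal{A}$-modules, and $\phi\colon\iota^{-1}\mathcal{B}_1'\to\iota^{-1}\mathcal{B}_2'$ denotes the composite isomorphism, then $\phi$ is induced by an isomorphism $\Phi\colon\mathcal{B}_1'|_P\to\mathcal{B}_2'|_P$ of $\mathcal{O}_P$-modules on an open neighbourhood $P$ of $M$ in $N$ (that is, $\iota^{-1}\Phi=\phi$). Such a morphism $\Phi$ is unique as a germ of homomorphisms over a neighbourhood of $M$.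
   Context: Manifolds are required to be paracompact (and Hausdorff). $\mathcal{O}_X$ denotes the sheaf of holomorphic functions on a complex manifold $X$, and $\iota^{-1}$ denotes the topological inverse image of sheaves. $M$ is identified with its image in $M'$. Since $\mathcal{O}_{M'}$ is coherent by Oka's theorem, $\mathcal{A}=\iota^{-1}\mathcal{O}_{M'}$ is a coherent sheaf of algebras, and a coherent $\mathcal{A}$-module is the same as a locally finitely presented $\mathcal{A}$-module: each $x\in M$ has an open neighbourhood $U$ in $M$ with an exact sequence $\mathcal{A}|_U^{\oplus k}\to\mathcal{A}|_U^{\oplus l}\to\mathcal{B}|_U\to 0$ of $\mathcal{A}|_U$-modules for some $k,l\in\mathbb{N}$. ''Unique as a germ'' means that any two such homomorphisms agree on some common open neighbourhood of $M$. *)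

(* Defs.v *)
From HB Require Import structures.
From mathcomp Require Import all_boot all_order all_algebra.
From mathcomp Require Import complex.
From mathcomp Require Import all_classical all_reals all_analysis.
Set Implicit Arguments.
Unset Strict Implicit.
Unset Printing Implicit Defensive.
Import Order.TTheory GRing.Theory Num.Theory.
Import numFieldNormedType.Exports.
Local Open Scope classical_set_scope.
Local Open Scope ring_scope.

(* The field of complex numbers, typed so that its norm topology is found and
   [differentiable] on ['rV[CC R]_n] means complex differentiability. *)
Definition CC (R : realType) : numFieldType := R[i].

Lemma near_open (X : topologicalType) (x : X) (P : X -> Prop) :
  (\forall y \near x, P y) ->
  exists V, [/\ open V, V x & forall y, V y -> P y].
Proof.
move=> /nbhs_interior nP; exists P^°; split; first exact: open_interior.
  exact: nbhs_singleton nP.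
exact: interior_subset.
Qed.

Definition paracompact (X : topologicalType) : Prop :=
  forall A : set (set X), A `<=` open -> \bigcup_(U in A) U = setT ->
  exists B : set (set X), [/\ B `<=` open, \bigcup_(V in B) V = setT,
    forall V, B V -> exists2 U, A U & V `<=` U
  & forall x : X, exists2 W : set X, nbhs x W & finite_set [set V | B V /\ V `&` W !=set0]].

(* [cmap] is a homeomorphism from [cdom] onto the open set [cmap @` cdom], with
   inverse [cinv]; the values of [cmap] and [cinv] elsewhere are irrelevant. *)
Record chart (R : realType) (X : topologicalType) := Chart {
  cdim : nat;
  cdom : set X;
  cmap : X -> 'rV[CC R]_cdim;
  cinv : 'rV[CC R]_cdim -> X;
  cdom_open : open cdom;
  cimg_open : open (cmap @` cdom);
  cmapK : forall x, cdom x -> cinv (cmap x) = x;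
  cmap_cont : forall x, cdom x -> {for x, continuous cmap};
  cinv_cont : forall x, cdom x -> {for cmap x, continuous cinv} }.
Arguments cinv {R X} c _.

(* Distinct connected components may have distinct dimensions. *)
Record complexManifold (R : realType) := ComplexManifold {
  carrier :> topologicalType;
  atlas : set (chart R carrier);
  manifold_hausdorff : hausdorff_space carrier;
  manifold_paracompact : paracompact carrier;
  atlas_cover : forall x, exists2 c, atlas c & cdom c x;
  atlas_compat : forall c c', atlas c -> atlas c' ->
    forall x, cdom c x -> cdom c' x ->
    differentiable (cmap c' \o cinv c) (cmap c x) }.

Record closed_embedding (R : realType) (M M' : complexManifold R)
    (f : M -> M') : Prop := ClosedEmbedding {
  embedding_continuous : continuous f;
  embedding_holomorphic : forall c c', atlas c -> atlas c' ->
    forall x, cdom c x -> cdom c' (f x) ->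
    differentiable (cmap c' \o f \o cinv c) (cmap c x);
  embedding_immersion : forall c c', atlas c -> atlas c' ->
    forall x, cdom c x -> cdom c' (f x) ->
    injective ('d (cmap c' \o f \o cinv c) (cmap c x));
  embedding_injective : injective f;
  embedding_homeo_range :
    forall U, open U -> exists2 W, open W & U = f @^-1` W;
  embedding_closed_range : closed (range f) }.

(* A sheaf F on an open subset D of X is given by its stalks S x = F_x, x in D,
   together with, for each open U contained in D, the set F(U) of sections over
   U, realized inside the product of the S x for x in U (as it always can be,
   by sending a section to the family of its germs; equivalently, F(U) is the
   set of continuous sections over U of the etale space of F). Such a
   family is represented by a function defined on the whole of X, of which only
   the restriction to U matters ([sec_ext]); likewise S x is irrelevant for
   x outside D. [sec_res] and [sec_glue] are the sheaf axioms, while [sec_germ]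
   and [sec_eq] say that S x is the colimit of the F(U) over the open
   neighbourhoods U of x. *)
Record sheafOn (X : topologicalType) (D : set X) (S : X -> Type) := SheafOn {
  sec :> set X -> (forall x, S x) -> Prop;
  sec_ext : forall U s t, open U -> U `<=` D ->
    (forall x, U x -> s x = t x) -> sec U s -> sec U t;
  sec_res : forall U V s, open U -> U `<=` D -> open V -> V `<=` U ->
    sec U s -> sec V s;
  sec_glue : forall U s, open U -> U `<=` D ->
    (forall x, U x -> exists V, [/\ open V, V x, V `<=` U & sec V s]) ->
    sec U s;
  sec_germ : forall x, D x -> forall a : S x,
    exists U s, [/\ open U, U x, U `<=` D, sec U s & s x = a];
  sec_eq : forall U s t x, open U -> U `<=` D -> sec U s -> sec U t ->
    U x -> s x = t x ->
    exists V, [/\ open V, V x, V `<=` U & forall y, V y -> s y = t y] }.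

(* Sheaves of K-algebras (commutative, with non-zero stalks). *)
Record algSheaf (K : comNzRingType) (X : topologicalType) := AlgSheaf {
  astalk :> X -> comAlgType K;
  asec : sheafOn setT (fun x => astalk x : Type);
  asec1 : forall U, open U -> asec U (fun=> 1);
  asecD : forall U s t, open U -> asec U s -> asec U t ->
    asec U (fun x => s x + t x);
  asecM : forall U s t, open U -> asec U s -> asec U t ->
    asec U (fun x => s x * t x);
  asecZ : forall U k s, open U -> asec U s -> asec U (fun x => k *: s x) }.

(* Sheaves of modules over O|_D, for D open in X. *)
Record modSheaf (K : comNzRingType) (X : topologicalType) (O : algSheaf K X)
    (D : set X) := ModSheaf {
  mstalk :> forall x, lmodType (O x);
  msec : sheafOn D (fun x => mstalk x : Type);
  msec0 : forall U, open U -> U `<=` D -> msec U (fun=> 0);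
  msecD : forall U s t, open U -> U `<=` D -> msec U s -> msec U t ->
    msec U (fun x => s x + t x);
  msecZ : forall U a s, open U -> U `<=` D -> asec O U a -> msec U s ->
    msec U (fun x => a x *: s x) }.

Section Morphisms.
Context (K : comNzRingType) (X : topologicalType) (O : algSheaf K X).

(* Homomorphisms B1|_P -> B2|_P of O|_P-modules, for P open and contained in D1
   and D2; the components at points outside P are irrelevant. *)
Record modHom (P D1 D2 : set X) (B1 : modSheaf O D1) (B2 : modSheaf O D2) :=
    ModHom {
  hmap :> forall x, {linear B1 x -> B2 x};
  hmap_sec : forall U s, open U -> U `<=` P ->
    msec B1 U s -> msec B2 U (fun x => hmap x (s x)) }.

Definition hom_comp P D1 D2 D3 (B1 : modSheaf O D1) (B2 : modSheaf O D2)
    (B3 : modSheaf O D3) (g : modHom P B2 B3) (f : modHom P B1 B2) :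
    modHom P B1 B3 :=
  ModHom (hmap := fun x => (g x \o f x : {linear B1 x -> B3 x}))
    (fun U s oU UP Us => hmap_sec g oU UP (hmap_sec f oU UP Us)).

Record modIso (P D1 D2 : set X) (B1 : modSheaf O D1) (B2 : modSheaf O D2) :=
    ModIso {
  iso_hom :> modHom P B1 B2;
  iso_inv : modHom P B2 B1;
  iso_homK : forall x, P x -> cancel (iso_hom x) (iso_inv x);
  iso_invK : forall x, P x -> cancel (iso_inv x) (iso_hom x) }.

Definition hom_eq (P : set X) P1 P2 D1 D2 (B1 : modSheaf O D1)
    (B2 : modSheaf O D2) (f : modHom P1 B1 B2) (g : modHom P2 B1 B2) : Prop :=
  forall x, P x -> f x =1 g x.

End Morphisms.

Section Free.
Context (K : comNzRingType) (X : topologicalType) (O : algSheaf K X) (k : nat).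

Definition fsec (U : set X) (s : forall x, 'rV[O x]_k) : Prop :=
  forall i, asec O U (fun x => s x ord0 i).

Fact fsec_ext U s t : open U -> U `<=` setT ->
  (forall x, U x -> s x = t x) -> fsec U s -> fsec U t.
Proof. by move=> oU _ st sU i; apply: sec_ext (sU i) => // x Ux; rewrite st. Qed.

Fact fsec_res U V s : open U -> U `<=` setT -> open V -> V `<=` U ->
  fsec U s -> fsec V s.
Proof. by move=> oU _ oV VU sU i; apply: sec_res (sU i). Qed.

Fact fsec_glue U s : open U -> U `<=` setT ->
  (forall x, U x -> exists V, [/\ open V, V x, V `<=` U & fsec V s]) ->
  fsec U s.
Proof.
move=> oU _ H i; apply: sec_glue => // x Ux.
by have [V [oV Vx VU sV]] := H x Ux; exists V; split.
Qed.

Fact common_nbhs (x : X) (W : 'I_k -> set X) :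
  (forall i, open (W i) /\ W i x) ->
  exists V, [/\ open V, V x & forall i, V `<=` W i].
Proof.
move=> oW; have : \forall y \near x, forall i, W i y.
  by apply: filter_forall => i; apply: open_nbhs_nbhs; apply: oW.
by move=> /near_open[V [oV Vx VW]]; exists V; split=> // i y /VW.
Qed.

Fact fsec_germ x : setT x -> forall a : 'rV[O x]_k,
  exists U s, [/\ open U, U x, U `<=` setT, fsec U s & s x = a].
Proof.
move=> _ a.
have /choice[W] : forall i, exists W, exists s,
    [/\ open W, W x, asec O W s & s x = a ord0 i].
  move=> i; have [W [s [oW Wx _ sW sx]]] := sec_germ (asec O) I (a ord0 i).
  by exists W, s.
move=> /choice[s Ws].
have [|V [oV Vx VW]] := common_nbhs (x := x) (W := W).
  by move=> i; have [] := Ws i.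
exists V, (fun y => \row_i s i y); split=> //.
- move=> i; have [oW _ sW _] := Ws i.
  apply: (sec_ext (s := s i)) => //; first by move=> y _; rewrite mxE.
  exact: sec_res sW.
- by apply/rowP => i; rewrite mxE; have [] := Ws i.
Qed.

Fact fsec_eq U s t x : open U -> U `<=` setT -> fsec U s -> fsec U t ->
  U x -> s x = t x ->
  exists V, [/\ open V, V x, V `<=` U & forall y, V y -> s y = t y].
Proof.
move=> oU _ sU tU Ux st.
have /choice[W HW] : forall i, exists W,
    [/\ open W, W x, W `<=` U & forall y, W y -> s y ord0 i = t y ord0 i].
  by move=> i; apply: sec_eq (sU i) (tU i) Ux _; rewrite ?st.
have [|V [oV Vx VW]] := common_nbhs (x := x) (W := W).
  by move=> i; have [] := HW i.
exists (V `&` U); split=> [|//||y [Vy _]]; [exact: openI | exact: subIsetr |].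
by apply/rowP => i; have [_ _ _] := HW i; apply; apply: VW.
Qed.

Fact fsec0 U : open U -> U `<=` setT -> fsec U (fun=> 0).
Proof.
move=> oU UT i; have h : asec O U (fun=> 0 *: 1) by apply/asecZ/asec1.
by apply: sec_ext h => // x _; rewrite scale0r mxE.
Qed.

Fact fsecD U s t : open U -> U `<=` setT -> fsec U s -> fsec U t ->
  fsec U (fun x => s x + t x).
Proof.
move=> oU UT sU tU i; apply: sec_ext (asecD oU (sU i) (tU i)) => // x _.
by rewrite mxE.
Qed.

Fact fsecZ U a s : open U -> U `<=` setT -> asec O U a -> fsec U s ->
  fsec U (fun x => a x *: s x).
Proof.
move=> oU UT aU sU i; apply: sec_ext (asecM oU aU (sU i)) => // x _.
by rewrite mxE.
Qed.

(* O^k, as a sheaf of row vectors. *)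
Definition free_mod : modSheaf O setT :=
  @ModSheaf K X O setT (fun x => 'rV[O x]_k)
    (SheafOn fsec_ext fsec_res fsec_glue fsec_germ fsec_eq) fsec0 fsecD fsecZ.

End Free.

(* Local finite presentation; exactness of O^k -> O^l -> B -> 0 over U is
   exactness of the sequences of stalks. For the sheaf of holomorphic functions
   on a complex manifold and its inverse images under closed embeddings, which
   are coherent sheaves of rings by Oka's theorem, this is coherence. *)
Definition coherent (K : comNzRingType) (X : topologicalType)
    (O : algSheaf K X) (D : set X) (B : modSheaf O D) : Prop :=
  forall x, D x -> exists U, [/\ open U, U x, U `<=` D &
    exists (k l : nat) (u : modHom U (free_mod O k) (free_mod O l))
      (v : modHom U (free_mod O l) B),
      forall y, U y ->
        (forall b, exists a, v y a = b) /\
        (forall a, v y a = 0 <-> exists c, u y c = a)].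

Section Pull.
Context (X Y : topologicalType) (f : Y -> X).
Hypothesis cf : continuous f.

Section PullSheaf.
Context (D : set X) (S : X -> Type) (F : sheafOn D S).

(* The inverse image has stalks (f^-1 F)_y = F_(f y); its sections are the
   families of germs which locally come from sections of F. *)
Definition pull_sec (V : set Y) (s : forall y, S (f y)) : Prop :=
  forall y, V y -> exists U t, [/\ open U, U (f y), U `<=` D, F U t &
    \forall z \near y, s z = t (f z)].

Fact psec_ext U s t : open U -> U `<=` f @^-1` D ->
  (forall x, U x -> s x = t x) -> pull_sec U s -> pull_sec U t.
Proof.
move=> oU _ st sU y Uy; have [W [r [oW Wy WD rW sr]]] := sU y Uy.
exists W, r; split=> //; have nU : nbhs y U by exact: open_nbhs_nbhs.
by apply: filterS2 sr nU => z sz Uz; rewrite -st.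
Qed.

Fact psec_res U V s : open U -> U `<=` f @^-1` D -> open V -> V `<=` U ->
  pull_sec U s -> pull_sec V s.
Proof. by move=> _ _ _ VU sU y /VU; apply: sU. Qed.

Fact psec_glue U s : open U -> U `<=` f @^-1` D ->
  (forall x, U x -> exists V, [/\ open V, V x, V `<=` U & pull_sec V s]) ->
  pull_sec U s.
Proof. by move=> _ _ H y /H[V [_ Vy _ sV]]; apply: sV. Qed.

Fact psec_germ y : (f @^-1` D) y -> forall a : S (f y),
  exists U s, [/\ open U, U y, U `<=` f @^-1` D, pull_sec U s & s y = a].
Proof.
move=> Dy a; have [U [t [oU Uy UD tU <-]]] := sec_germ F Dy a.
exists (f @^-1` U), (fun z => t (f z)); split=> //.
- by apply: open_comp => // z _; apply: cf.
- by move=> z /UD.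
- by move=> z Uz; exists U, t; split=> //; apply: nearW.
Qed.

Fact psec_eq U s t y : open U -> U `<=` f @^-1` D ->
  pull_sec U s -> pull_sec U t -> U y -> s y = t y ->
  exists V, [/\ open V, V y, V `<=` U & forall z, V z -> s z = t z].
Proof.
move=> oU UD sU tU Uy st.
have [W1 [s1 [oW1 W1y W1D s1W ss1]]] := sU y Uy.
have [W2 [t1 [oW2 W2y W2D t1W tt1]]] := tU y Uy.
have oW : open (W1 `&` W2) by exact: openI.
have WD : W1 `&` W2 `<=` D by move=> z [/W1D].
have s1W' := sec_res oW1 W1D oW (@subIsetl _ _ _) s1W.
have t1W' := sec_res oW2 W2D oW (@subIsetr _ _ _) t1W.
have [|V [oV Vy VW st1]] := sec_eq oW WD s1W' t1W' (conj W1y W2y).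
  by rewrite -(nbhs_singleton ss1) -(nbhs_singleton tt1).
have nV : \forall z \near y, V (f z) by apply: cf; exact: open_nbhs_nbhs.
have nU : nbhs y U by exact: open_nbhs_nbhs.
have : \forall z \near y, U z /\ s z = t z.
  by near=> z; split; [near: z | rewrite (near ss1) ?(near tt1) ?st1 //; near: z].
by move=> /near_open[V' [oV' V'y V'P]]; exists V'; split=> // z /V'P[].
Unshelve. all: by end_near. Qed.

Definition pull : sheafOn (f @^-1` D) (fun y => S (f y)) :=
  SheafOn psec_ext psec_res psec_glue psec_germ psec_eq.

Fact pull_comp U t : open U -> U `<=` D -> F U t ->
  pull (f @^-1` U) (fun y => t (f y)).
Proof. by move=> oU UD tU y Uy; exists U, t; split=> //; apply: nearW. Qed.

Fact pull_sec2 V y s1 s2 : pull V s1 -> pull V s2 -> V y ->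
  exists U t1 t2, [/\ open U, U (f y), U `<=` D, F U t1 /\ F U t2 &
    \forall z \near y, s1 z = t1 (f z) /\ s2 z = t2 (f z)].
Proof.
move=> s1V s2V Vy.
have [W1 [t1 [oW1 W1y W1D t1W st1]]] := s1V y Vy.
have [W2 [t2 [oW2 W2y W2D t2W st2]]] := s2V y Vy.
have oW : open (W1 `&` W2) by exact: openI.
exists (W1 `&` W2), t1, t2; split=> //.
- by move=> z [/W1D].
- by split; [apply: sec_res t1W | apply: sec_res t2W] => // z [].
- by apply: filterS2 st1 st2.
Qed.

End PullSheaf.

Context (K : comNzRingType) (O : algSheaf K X).

Fact pull_alg1 U : open U -> pull (asec O) U (fun=> 1).
Proof.
move=> oU y _; exists setT, (fun=> 1).
by split=> //; [exact: openT | apply: asec1; exact: openT | exact: nearW].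
Qed.

Fact pull_algD U s t : open U -> pull (asec O) U s -> pull (asec O) U t ->
  pull (asec O) U (fun x => s x + t x).
Proof.
move=> oU sU tU y Uy; have [W [s1 [t1 [oW Wy _ [s1W t1W] st]]]] := pull_sec2 sU tU Uy.
exists W, (fun x => s1 x + t1 x); split=> //; first exact: asecD.
by apply: filterS st => z [-> ->].
Qed.

Fact pull_algM U s t : open U -> pull (asec O) U s -> pull (asec O) U t ->
  pull (asec O) U (fun x => s x * t x).
Proof.
move=> oU sU tU y Uy; have [W [s1 [t1 [oW Wy _ [s1W t1W] st]]]] := pull_sec2 sU tU Uy.
exists W, (fun x => s1 x * t1 x); split=> //; first exact: asecM.
by apply: filterS st => z [-> ->].
Qed.

Fact pull_algZ U k s : open U -> pull (asec O) U s ->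
  pull (asec O) U (fun x => k *: s x).
Proof.
move=> oU sU y Uy; have [W [s1 [oW Wy _ s1W ss]]] := sU y Uy.
exists W, (fun x => k *: s1 x); split=> //; first exact: asecZ.
by apply: filterS ss => z ->.
Qed.

Definition pull_alg : algSheaf K Y :=
  @AlgSheaf K Y (fun y => O (f y)) (pull (asec O))
    pull_alg1 pull_algD pull_algM pull_algZ.

Section PullMod.
Context (D : set X) (B : modSheaf O D).

Fact pull_mod0 U : open U -> U `<=` f @^-1` D -> pull (msec B) U (fun=> 0).
Proof.
move=> oU UD y /UD Dy; have [W [_ [oW Wy WD _ _]]] := sec_germ (msec B) Dy 0.
by exists W, (fun=> 0); split=> //; [exact: msec0 | exact: nearW].
Qed.

Fact pull_modD U s t : open U -> U `<=` f @^-1` D ->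
  pull (msec B) U s -> pull (msec B) U t -> pull (msec B) U (fun x => s x + t x).
Proof.
move=> oU _ sU tU y Uy; have [W [s1 [t1 [oW Wy WD [s1W t1W] st]]]] := pull_sec2 sU tU Uy.
exists W, (fun x => s1 x + t1 x); split=> //; first exact: msecD.
by apply: filterS st => z [-> ->].
Qed.

Fact pull_modZ U a s : open U -> U `<=` f @^-1` D ->
  asec pull_alg U a -> pull (msec B) U s -> pull (msec B) U (fun x => a x *: s x).
Proof.
move=> oU _ aU sU y Uy.
have [W1 [a1 [oW1 W1y _ a1W aa]]] := aU y Uy.
have [W2 [s1 [oW2 W2y W2D s1W ss]]] := sU y Uy.
have oW : open (W1 `&` W2) by exact: openI.
have WD : W1 `&` W2 `<=` D by move=> z [_ /W2D].
exists (W1 `&` W2), (fun x => a1 x *: s1 x); split=> //.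
- by apply: msecZ => //; [apply: sec_res a1W | apply: sec_res s1W] => // z [].
- by apply: filterS2 aa ss => z -> ->.
Qed.

Definition pull_mod : modSheaf pull_alg (f @^-1` D) :=
  @ModSheaf K Y pull_alg (f @^-1` D) (fun y => B (f y)) (pull (msec B))
    pull_mod0 pull_modD pull_modZ.

End PullMod.

Section PullHom.
Context (P D1 D2 : set X) (B1 : modSheaf O D1) (B2 : modSheaf O D2).
Hypotheses (oP : open P) (PD2 : P `<=` D2).
Variable g : modHom P B1 B2.

Fact pull_hom_sec U s : open U -> U `<=` f @^-1` P ->
  msec (pull_mod B1) U s ->
  msec (pull_mod B2) U (fun y => g (f y) (s y)).
Proof.
move=> oU UP sU y Uy; have [W [s1 [oW Wy WD s1W ss]]] := sU y Uy.
have oWP : open (W `&` P) by exact: openI.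
exists (W `&` P), (fun x => g x (s1 x)); split=> //.
- by split=> //; apply: UP.
- by move=> z [_ /PD2].
- exact: (hmap_sec g oWP (@subIsetr _ _ _) (sec_res oW WD oWP (@subIsetl _ _ _) s1W)).
- by apply: filterS ss => z ->.
Qed.

Definition pull_hom : modHom (f @^-1` P) (pull_mod B1) (pull_mod B2) :=
  @ModHom _ _ _ _ _ _ (pull_mod B1) (pull_mod B2) (fun y => g (f y))
    pull_hom_sec.

End PullHom.

End Pull.

Lemma near_eq_differentiable (C : numFieldType) (V W : normedModType C)
    (f g : V -> W) (a : V) :
  (\forall x \near a, f x = g x) -> differentiable f a -> differentiable g a.
Proof.
move=> fg df.
have fga : f a = g a by exact: nbhs_singleton fg.
have fg0 : \forall h \near (0 : V), f (h + a) = g (h + a).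
  by move: fg; rewrite (near_shift 0); apply: filterS => z /=; rewrite subr0.
have [cdf /eqaddoP ef] := (diff_locallyP a f).1 df.
have eg : g \o shift a = cst (g a) + 'd f a +o_ (0 : V) id.
  apply/eqaddoP => e e0; move: (ef e e0); apply: filterS2 fg0 => h /=.
  by rewrite !fctE /= -fga => ->.
by apply/diff_locallyP; rewrite (diff_unique cdf eg); split.
Qed.

Section Holomorphic.
Context (R : realType) (X : complexManifold R).
Notation C := (CC R).

Definition holomorphic_at (f : X -> C) (x : X) : Prop :=
  forall c, atlas c -> cdom c x -> differentiable (f \o cinv c) (cmap c x).

Definition holomorphic_near (x : X) (f : X -> C) : Prop :=
  \forall y \near x, holomorphic_at f y.

Lemma holomorphic_at_ext (f g : X -> C) (x : X) :
  (\forall y \near x, f y = g y) -> holomorphic_at f x -> holomorphic_at g x.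
Proof.
move=> fg hf c ac cx; apply: near_eq_differentiable (hf c ac cx).
have h : cinv c @ cmap c x --> cinv c (cmap c x) := cinv_cont cx.
by rewrite cmapK // in h; exact: h fg.
Qed.

Lemma holomorphic_cst (k : C) (x : X) : holomorphic_at (fun=> k) x.
Proof. by move=> c _ _; exact: differentiable_cst. Qed.

Lemma holomorphicD (f g : X -> C) (x : X) :
  holomorphic_at f x -> holomorphic_at g x ->
  holomorphic_at (fun y => f y + g y) x.
Proof. by move=> hf hg c ac cx; apply: differentiableD; [exact: hf | exact: hg]. Qed.

Lemma holomorphicM (f g : X -> C) (x : X) :
  holomorphic_at f x -> holomorphic_at g x ->
  holomorphic_at (fun y => f y * g y) x.
Proof. by move=> hf hg c ac cx; apply: differentiableM; [exact: hf | exact: hg]. Qed.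

Section Germ.
Variable x : X.

Definition near_fun : Type := {f : X -> C | `[< holomorphic_near x f >]}.
HB.instance Definition _ := Choice.on near_fun.

Definition germ_rel (f g : near_fun) : bool :=
  `[< \forall y \near x, val f y = val g y >].

Lemma germ_rel_equiv : equiv_class_of germ_rel.
Proof.
split=> [f|f g|g f h].
- by apply/asboolP; exact: nearW.
- by apply/asboolP/asboolP; apply: filterS => y ->.
- move=> /asboolP fg /asboolP gh; apply/asboolP.
  by apply: filterS2 fg gh => y -> ->.
Qed.

Canonical germ_equiv := EquivRelPack germ_rel_equiv.

Definition germ_type := {eq_quot germ_rel}%qT.
HB.instance Definition _ := Choice.on germ_type.

Lemma near0P : `[< holomorphic_near x (fun=> 0) >].
Proof. by apply/asboolP; apply: nearW => y; exact: holomorphic_cst. Qed.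

(* The germ of f at x if f is holomorphic near x; junk (namely 0) otherwise. *)
Definition germ (f : X -> C) : germ_type :=
  (\pi_germ_type%qT (insubd (Sub (fun=> 0) near0P : near_fun) f)).

Definition germ_fun (a : germ_type) : X -> C := val (repr a).

Lemma germ_funP a : holomorphic_near x (germ_fun a).
Proof. exact/asboolP/(valP (repr a)). Qed.

Lemma germ_funK a : germ (germ_fun a) = a.
Proof. by rewrite /germ valKd reprK. Qed.

Lemma germ_eq f g : holomorphic_near x f -> holomorphic_near x g ->
  (\forall y \near x, f y = g y) <-> germ f = germ g.
Proof.
move=> hf hg; rewrite /germ; split.
  move=> fg; apply/eqP; rewrite eqmodE /= /germ_rel.
  by apply/asboolP; rewrite !insubdK//; exact/asboolP.
move=> /eqP; rewrite eqmodE /= => /asboolP.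
by rewrite !insubdK//; exact/asboolP.
Qed.

Lemma germE f : holomorphic_near x f ->
  \forall y \near x, germ_fun (germ f) y = f y.
Proof.
by move=> hf; apply/(germ_eq (germ_funP _) hf); exact: germ_funK.
Qed.

Lemma near_cst k : holomorphic_near x (fun=> k).
Proof. by apply: nearW => y; exact: holomorphic_cst. Qed.

Lemma nearD f g : holomorphic_near x f -> holomorphic_near x g ->
  holomorphic_near x (fun y => f y + g y).
Proof. by apply: filterS2 => y; exact: holomorphicD. Qed.

Lemma nearM f g : holomorphic_near x f -> holomorphic_near x g ->
  holomorphic_near x (fun y => f y * g y).
Proof. by apply: filterS2 => y; exact: holomorphicM. Qed.

Definition germ_zero : germ_type := germ (fun=> 0).
Definition germ_one : germ_type := germ (fun=> 1).
Definition germ_add (a b : germ_type) : germ_type :=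
  germ (fun y => germ_fun a y + germ_fun b y).
Definition germ_mul (a b : germ_type) : germ_type :=
  germ (fun y => germ_fun a y * germ_fun b y).
Definition germ_opp (a : germ_type) : germ_type := germ_mul (germ (fun=> -1)) a.
Definition germ_scale (k : C) (a : germ_type) : germ_type :=
  germ_mul (germ (fun=> k)) a.

Lemma germD f g : holomorphic_near x f -> holomorphic_near x g ->
  germ_add (germ f) (germ g) = germ (fun y => f y + g y).
Proof.
move=> hf hg; apply/germ_eq.
- by apply: nearD; exact: germ_funP.
- exact: nearD.
- by apply: filterS2 (germE hf) (germE hg) => y -> ->.
Qed.

Lemma germM f g : holomorphic_near x f -> holomorphic_near x g ->
  germ_mul (germ f) (germ g) = germ (fun y => f y * g y).
Proof.
move=> hf hg; apply/germ_eq.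
- by apply: nearM; exact: germ_funP.
- exact: nearM.
- by apply: filterS2 (germE hf) (germE hg) => y -> ->.
Qed.

Lemma germZ k f : holomorphic_near x f ->
  germ_scale k (germ f) = germ (fun y => k * f y).
Proof. by move=> hf; apply: germM => //; exact: near_cst. Qed.

Lemma germ_ind (P : germ_type -> Prop) :
  (forall f, holomorphic_near x f -> P (germ f)) -> forall a, P a.
Proof. by move=> H a; rewrite -(germ_funK a); exact/H/germ_funP. Qed.

Fact germ_addA : associative germ_add.
Proof.
elim/germ_ind=> f hf; elim/germ_ind=> g hg; elim/germ_ind=> h hh.
rewrite !germD//; do ?exact: nearD.
by congr germ; apply/funext => y; rewrite addrA.
Qed.

Fact germ_addC : commutative germ_add.
Proof.
elim/germ_ind=> f hf; elim/germ_ind=> g hg; rewrite !germD//.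
by congr germ; apply/funext => y; rewrite addrC.
Qed.

Fact germ_add0 : left_id germ_zero germ_add.
Proof.
elim/germ_ind=> f hf; rewrite germD//; last exact: near_cst.
by congr germ; apply/funext => y; rewrite add0r.
Qed.

Fact germ_addN : left_inverse germ_zero germ_opp germ_add.
Proof.
elim/germ_ind=> f hf; rewrite /germ_opp germM//; last exact: near_cst.
rewrite germD//; last by apply: nearM => //; exact: near_cst.
by congr germ; apply/funext => y; rewrite mulN1r addNr.
Qed.

HB.instance Definition _ := GRing.isZmodule.Build germ_type
  germ_addA germ_addC germ_add0 germ_addN.

Fact germ_mulA : associative germ_mul.
Proof.
elim/germ_ind=> f hf; elim/germ_ind=> g hg; elim/germ_ind=> h hh.
rewrite !germM//; do ?exact: nearM.
by congr germ; apply/funext => y; rewrite mulrA.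
Qed.

Fact germ_mulC : commutative germ_mul.
Proof.
elim/germ_ind=> f hf; elim/germ_ind=> g hg; rewrite !germM//.
by congr germ; apply/funext => y; rewrite mulrC.
Qed.

Fact germ_mul1 : left_id germ_one germ_mul.
Proof.
elim/germ_ind=> f hf; rewrite germM//; last exact: near_cst.
by congr germ; apply/funext => y; rewrite mul1r.
Qed.

Fact germ_mulDl : left_distributive germ_mul germ_add.
Proof.
elim/germ_ind=> f hf; elim/germ_ind=> g hg; elim/germ_ind=> h hh.
rewrite germD// !germM//; last exact: nearD.
rewrite germD//; do ?exact: nearM.
by congr germ; apply/funext => y; rewrite mulrDl.
Qed.

Fact germ_1neq0 : germ_one != germ_zero.
Proof.
apply/eqP => /germ_eq H; have := H (near_cst _) (near_cst _).
by move=> /nbhs_singleton /eqP; rewrite oner_eq0.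
Qed.

HB.instance Definition _ := GRing.Zmodule_isComNzRing.Build germ_type
  germ_mulA germ_mulC germ_mul1 germ_mulDl germ_1neq0.

Fact germ_scaleA k l a : germ_scale k (germ_scale l a) = germ_scale (k * l) a.
Proof.
rewrite /germ_scale germ_mulA germM; do ?exact: near_cst.
by [].
Qed.

Fact germ_scale1 : left_id 1 germ_scale.
Proof. exact: germ_mul1. Qed.

Fact germ_scaleDr : right_distributive germ_scale +%R.
Proof. by move=> k a b; exact: (mulrDr (germ (fun=> k)) a b). Qed.

Fact germ_scaleDl a : {morph germ_scale^~ a : k l / k + l}.
Proof.
move=> k l; rewrite -[RHS]germ_mulDl germD; do ?exact: near_cst.
by [].
Qed.

HB.instance Definition _ := GRing.Zmodule_isLmodule.Build C germ_type
  germ_scaleA germ_scale1 germ_scaleDr germ_scaleDl.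

Fact germ_scaleAl k (a b : germ_type) : k *: (a * b) = (k *: a) * b.
Proof. exact: germ_mulA. Qed.

HB.instance Definition _ := GRing.Lmodule_isLalgebra.Build C germ_type
  germ_scaleAl.
HB.instance Definition _ := GRing.Lalgebra_isComAlgebra.Build C germ_type.

End Germ.

(* The sections over U are the families of germs of a holomorphic function on
   U. *)
Definition holo_sec (U : set X) (s : forall x, germ_type x) : Prop :=
  exists2 f : X -> C, (forall x, U x -> holomorphic_at f x) &
    forall x, U x -> s x = germ x f.

Lemma open_holomorphic (U : set X) f x : open U -> U x ->
  (forall y, U y -> holomorphic_at f y) -> holomorphic_near x f.
Proof.
move=> oU Ux hf; have nU : \forall y \near x, U y by exact: open_nbhs_nbhs.
exact: filterS nU.
Qed.

Fact holo_sec_ext U s t : open U -> U `<=` setT ->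
  (forall x, U x -> s x = t x) -> holo_sec U s -> holo_sec U t.
Proof. by move=> _ _ st [f hf sf]; exists f => // x Ux; rewrite -st ?sf. Qed.

Fact holo_sec_res U V s : open U -> U `<=` setT -> open V -> V `<=` U ->
  holo_sec U s -> holo_sec V s.
Proof.
by move=> _ _ _ VU [f hf sf]; exists f => x /VU; [exact: hf | exact: sf].
Qed.

Fact holo_sec_glue U s : open U -> U `<=` setT ->
  (forall x, U x -> exists V, [/\ open V, V x, V `<=` U & holo_sec V s]) ->
  holo_sec U s.
Proof.
move=> oU _ H; pose f x := germ_fun (s x) x.
suff Hf x : U x -> holomorphic_at f x /\ s x = germ x f.
  by exists f => x /Hf[].
move=> /H[V [oV Vx VU [g hg sg]]].
have fg : \forall y \near x, g y = f y.
  have : \forall y \near x, V y by exact: open_nbhs_nbhs.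
  apply: filterS => y Vy; rewrite /f sg //.
  by rewrite (nbhs_singleton (germE (open_holomorphic oV Vy hg))).
have hgx := open_holomorphic oV Vx hg.
have hfx : holomorphic_near x f.
  move: (near_join fg) hgx; apply: filterS2 => y; exact: holomorphic_at_ext.
split; first exact: nbhs_singleton hfx.
by rewrite sg//; exact/germ_eq.
Qed.

Fact holo_sec_germ x : setT x -> forall a : germ_type x,
  exists U s, [/\ open U, U x, U `<=` setT, holo_sec U s & s x = a].
Proof.
move=> _ a; have [U [oU Ux Uf]] := near_open (germ_funP a).
exists U, (fun y => germ y (germ_fun a)); split=> //; last exact: germ_funK.
by exists (germ_fun a).
Qed.

Fact holo_sec_eq U s t x : open U -> U `<=` setT ->
  holo_sec U s -> holo_sec U t -> U x -> s x = t x ->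
  exists V, [/\ open V, V x, V `<=` U & forall y, V y -> s y = t y].
Proof.
move=> oU _ [f hf sf] [g hg tg] Ux; rewrite sf// tg// => fg.
have hfx y (Uy : U y) := open_holomorphic oU Uy hf.
have hgx y (Uy : U y) := open_holomorphic oU Uy hg.
have /near_join fgx := (germ_eq (hfx _ Ux) (hgx _ Ux)).2 fg.
have [V [oV Vx VP]] := near_open fgx.
exists (V `&` U); split=> [|//||y [Vy Uy]]; [exact: openI | exact: subIsetr |].
rewrite sf// tg//; apply/germ_eq; [exact: hfx | exact: hgx | exact: VP].
Qed.

Fact holo_sec1 U : open U -> holo_sec U (fun=> 1).
Proof. by move=> _; exists (fun=> 1) => // x _; exact: holomorphic_cst. Qed.

Fact holo_secD U s t : open U -> holo_sec U s -> holo_sec U t ->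
  holo_sec U (fun x => s x + t x).
Proof.
move=> oU [f hf sf] [g hg tg]; exists (fun x => f x + g x) => x Ux.
  by apply: holomorphicD; [exact: hf | exact: hg].
by rewrite sf// tg//; apply: germD; exact: open_holomorphic Ux _.
Qed.

Fact holo_secM U s t : open U -> holo_sec U s -> holo_sec U t ->
  holo_sec U (fun x => s x * t x).
Proof.
move=> oU [f hf sf] [g hg tg]; exists (fun x => f x * g x) => x Ux.
  by apply: holomorphicM; [exact: hf | exact: hg].
by rewrite sf// tg//; apply: germM; exact: open_holomorphic Ux _.
Qed.

Fact holo_secZ U k s : open U -> holo_sec U s -> holo_sec U (fun x => k *: s x).
Proof.
move=> oU [f hf sf]; exists (fun x => k * f x) => x Ux.
  by apply: holomorphicM; [exact: holomorphic_cst | exact: hf].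
by rewrite sf//; apply: germZ; exact: open_holomorphic Ux _.
Qed.

Definition holo : algSheaf C X :=
  @AlgSheaf C X (fun x => germ_type x)
    (SheafOn holo_sec_ext holo_sec_res holo_sec_glue holo_sec_germ holo_sec_eq)
    holo_sec1 holo_secD holo_secM holo_secZ.

End Holomorphic.

(* Main.v *)
From HB Require Import structures.
Require Import Defs.
From mathcomp Require Import all_boot all_order all_algebra.
From mathcomp Require Import complex.
From mathcomp Require Import all_classical all_reals all_analysis.
Set Implicit Arguments.
Unset Strict Implicit.
Unset Printing Implicit Defensive.
Import Order.TTheory GRing.Theory Num.Theory.
Import numFieldNormedType.Exports.
Local Open Scope classical_set_scope.
Local Open Scope ring_scope.

(** The argument is topological. Let f : Y -> X be a continuous map inducing
    the topology of Y, with closed range, into a paracompact Hausdorff space X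
    carrying a sheaf of algebras O; the theorem is the case where X is M', Y is
    M and O is the sheaf of holomorphic functions.

    Near a point of Y everything extends to X because a finite presentation is
    a finite amount of data. A section of an inverse image comes, near a point,
    from a section downstairs, and two sections that agree at a point agree
    near it. A homomorphism out of a finitely presented module is a finite
    family of sections satisfying finitely many linear relations, hence extends
    ([hom_extend_local]), and two homomorphisms that agree at a point agree
    near it ([hom_eq_near]). A finitely presented module is the cokernel of a
    matrix of sections; extend the entries of the matrix and take the cokernel
    downstairs ([module_extend_local]).

    Paracompactness makes these extensions global. [paracompact_shrinking]
    replaces the neighbourhoods V_i carrying the local extensions by smaller
    sets K_i such that, near a point p, only the finitely many i with p in K_i
    occur. Extensions that agree at p therefore agree, all together, on a
    neighbourhood of p, and following at each q any extension whose index i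
    satisfies q in K_i gives a global homomorphism ([hom_extend]). Together
    with [hom_eq_near] this is part (ii): the extensions of phi and of its
    inverse are mutually inverse near Y ([iso_extend]).

    For part (i), let F_i on V_i be local extensions of B, with isomorphisms
    psi_i from their inverse images to B. Applying [hom_extend] on the closed
    set of points of Y lying in K_i and K_j extends psi_j^-1 psi_i to a
    homomorphism Phi_ij from F_i to F_j. The cocycle identities hold at the
    points of Y, hence, there being finitely many indices, on a neighbourhood
    of each of them. So the F_i glue along the Phi_ij to a module on a
    neighbourhood of Y ([glue_mod]), and the psi_i glue to an isomorphism of
    its inverse image with B ([module_extend]). *)

(** * Factoring linear maps and cokernels *)

Section LinearAlgebra.
Context (R : pzRingType).

Definition linear_of (V W : lmodType R) (g : V -> W) of linear g := g.

HB.instance Definition _ (V W : lmodType R) (g : V -> W) (lg : linear g) :=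
  GRing.isLinear.Build R V W *:%R (linear_of lg) lg.

(** Homomorphisms of sheaves are obtained stalk by stalk from this lemma, both
    the ones defined by the images of generators and the inverses of bijective
    ones. *)
Lemma linear_factor (E V W : lmodType R) (v : {linear E -> V})
    (w : {linear E -> W}) :
  (forall b, exists a, v a = b) -> (forall a, v a = 0 -> w a = 0) ->
  exists g : {linear V -> W}, forall a, g (v a) = w a.
Proof.
move=> /choice[s sK] vw; have wE a : w (s (v a)) = w a.
  by apply/eqP; rewrite -subr_eq0 -linearB vw ?linearB /= ?sK ?subrr.
pose g b := w (s b).
have lg : linear g.
  by move=> k b c; rewrite -{1}(sK b) -{1}(sK c) -linearP /g wE linearP.
by exists (linear_of lg : {linear V -> W}).
Qed.

Definition lincomb (V : lmodType R) l (b : 'I_l -> V) (a : 'rV[R]_l) : V :=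
  \sum_i a ord0 i *: b i.

Fact lincomb_is_linear (V : lmodType R) l (b : 'I_l -> V) :
  linear (lincomb b).
Proof.
move=> k a c; rewrite /lincomb scaler_sumr -big_split; apply: eq_bigr => i _.
by rewrite !mxE scalerDl scalerA.
Qed.

HB.instance Definition _ (V : lmodType R) l (b : 'I_l -> V) :=
  GRing.isLinear.Build R 'rV[R]_l V *:%R (lincomb b) (lincomb_is_linear b).

Lemma lincomb_delta (V : lmodType R) l (b : 'I_l -> V) i :
  lincomb b (delta_mx ord0 i) = b i.
Proof.
rewrite /lincomb (bigD1 i) //= big1 => [|j ji].
  by rewrite mxE !eqxx scale1r addr0.
rewrite mxE eqxx.
by rewrite (negPf ji) scale0r.
Qed.

Lemma linear_lincomb (V W : lmodType R) l (b : 'I_l -> V)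
    (g : {linear V -> W}) a :
  g (lincomb b a) = lincomb (fun i => g (b i)) a.
Proof. by rewrite linear_sum; apply: eq_bigr => i _; rewrite linearZ. Qed.

Lemma linear_rowE (V : lmodType R) l (g : {linear 'rV[R]_l -> V}) a :
  g a = lincomb (fun i => g (delta_mx ord0 i)) a.
Proof.
rewrite {1}[a]row_sum_delta linear_sum.
by apply: eq_bigr => i _; rewrite linearZ.
Qed.

Lemma lincomb_mul (V : lmodType R) k l (b : 'I_l -> V) (c : 'rV[R]_k)
    (r : 'M[R]_(k, l)) :
  lincomb b (c *m r) = lincomb (fun j => lincomb b (row j r)) c.
Proof.
by rewrite mulmx_sum_row linear_sum; apply: eq_bigr => j _; rewrite linearZ.
Qed.

(** The cokernel of f, as a quotient of the choice type W; it makes a presented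
    module out of a matrix of relations. *)
Section Coker.
Context (V W : lmodType R) (f : {linear V -> W}).

Definition coker_rel (u v : W) : bool := `[< exists c, u - v = f c >].

Lemma coker_relP : equiv_class_of coker_rel.
Proof.
split=> [u|u v|v u w].
- by apply/asboolP; exists 0; rewrite subrr linear0.
- by apply/asboolP/asboolP => -[c e]; exists (- c);
    rewrite [RHS]linearN /= -e opprB.
- move=> /asboolP[c e] /asboolP[d e']; apply/asboolP; exists (c + d).
  by rewrite linearD -e -e' addrA subrK.
Qed.

Canonical coker_equiv := EquivRelPack coker_relP.

Definition coker := {eq_quot coker_rel}%qT.
HB.instance Definition _ := Choice.on coker.

Definition coker_pi (w : W) : coker := \pi_coker%qT w.

Lemma coker_pi_surj a : exists w, coker_pi w = a.
Proof. by exists (repr a); rewrite /coker_pi reprK. Qed.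

Lemma coker_pi_eq u v : coker_pi u = coker_pi v <-> exists c, u - v = f c.
Proof.
split=> [/eqP|H]; first by rewrite eqmodE => /asboolP.
by apply/eqP; rewrite eqmodE; apply/asboolP.
Qed.

Definition coker_add (a b : coker) := coker_pi (repr a + repr b).
Definition coker_opp (a : coker) := coker_pi (- repr a).
Definition coker_scale k (a : coker) := coker_pi (k *: repr a).

Lemma coker_repr w : exists c, repr (coker_pi w) - w = f c.
Proof. by apply/coker_pi_eq; rewrite /coker_pi reprK. Qed.

Lemma coker_piD u v : coker_add (coker_pi u) (coker_pi v) = coker_pi (u + v).
Proof.
apply/coker_pi_eq; have [c e] := coker_repr u; have [d e'] := coker_repr v.
by exists (c + d); rewrite linearD /= -e -e' opprD addrACA.
Qed.

Lemma coker_piN u : coker_opp (coker_pi u) = coker_pi (- u).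
Proof.
apply/coker_pi_eq; have [c e] := coker_repr u.
by exists (- c); rewrite [RHS]linearN /= -e opprD.
Qed.

Lemma coker_piZ k u : coker_scale k (coker_pi u) = coker_pi (k *: u).
Proof.
apply/coker_pi_eq; have [c e] := coker_repr u.
by exists (k *: c); rewrite [RHS]linearZ /= -e scalerBr.
Qed.

Lemma coker_ind (P : coker -> Prop) :
  (forall w, P (coker_pi w)) -> forall a, P a.
Proof. by move=> H a; have [w <-] := coker_pi_surj a. Qed.

Fact coker_addA : associative coker_add.
Proof.
elim/coker_ind=> a; elim/coker_ind=> b; elim/coker_ind=> c.
by rewrite !coker_piD addrA.
Qed.

Fact coker_addC : commutative coker_add.
Proof.
by elim/coker_ind=> a; elim/coker_ind=> b; rewrite !coker_piD addrC.
Qed.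

Fact coker_add0 : left_id (coker_pi 0) coker_add.
Proof. by elim/coker_ind=> a; rewrite coker_piD add0r. Qed.

Fact coker_addN : left_inverse (coker_pi 0) coker_opp coker_add.
Proof. by elim/coker_ind=> a; rewrite coker_piN coker_piD addNr. Qed.

HB.instance Definition _ := GRing.isZmodule.Build coker
  coker_addA coker_addC coker_add0 coker_addN.

Fact coker_scaleA k l a :
  coker_scale k (coker_scale l a) = coker_scale (k * l) a.
Proof. by elim/coker_ind: a => a; rewrite !coker_piZ scalerA. Qed.

Fact coker_scale1 : left_id 1 coker_scale.
Proof. by elim/coker_ind=> a; rewrite coker_piZ scale1r. Qed.

Fact coker_scaleDr : right_distributive coker_scale +%R.
Proof.
move=> k; elim/coker_ind=> a; elim/coker_ind=> b.
by rewrite ![_ + _]coker_piD !coker_piZ [RHS]coker_piD scalerDr.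
Qed.

Fact coker_scaleDl a : {morph coker_scale^~ a : k l / k + l}.
Proof.
by elim/coker_ind: a => a k l; rewrite !coker_piZ [RHS]coker_piD scalerDl.
Qed.

HB.instance Definition _ := GRing.Zmodule_isLmodule.Build R coker
  coker_scaleA coker_scale1 coker_scaleDr coker_scaleDl.

Fact coker_pi_is_linear : linear coker_pi.
Proof. by move=> k u v; rewrite -coker_piD -coker_piZ. Qed.

HB.instance Definition _ := GRing.isLinear.Build R W coker *:%R coker_pi
  coker_pi_is_linear.

Lemma coker_pi_eq0 w : coker_pi w = 0 <-> exists c, f c = w.
Proof.
rewrite -(linear0 coker_pi) coker_pi_eq subr0.
by split=> -[c e]; exists c.
Qed.

End Coker.

End LinearAlgebra.

(** * Sheaves of modules given by their sections near a point *)

Section LocalSections.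
Context (K : comNzRingType) (X : topologicalType).

Lemma open_near (U : set X) x : open U -> U x -> \forall y \near x, U y.
Proof. by move=> oU Ux; exact: open_nbhs_nbhs. Qed.

Lemma sec_near (D : set X) (S : X -> Type) (F : sheafOn D S) U s :
  open U -> U `<=` D ->
  (forall x, U x -> exists V t, [/\ open V, V x, V `<=` D, F V t &
     \forall y \near x, s y = t y]) -> F U s.
Proof.
move=> oU UD H; apply: sec_glue => // x Ux.
have [V [t [oV Vx VD tV st]]] := H x Ux.
have [W [oW Wx WP]] :=
  near_open (filterI st (filterI (open_near oV Vx) (open_near oU Ux))).
exists W; split=> //; first by move=> y /WP[_ []].
apply: (@sec_ext _ _ _ _ _ t) => //.
- by move=> y /WP[_ [/VD]].
- by move=> y /WP[].
- by apply: (sec_res oV) tV => // y /WP[_ []].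
Qed.

(** The sections of a sheaf over an open set are the families of germs that are
    sections near each of its points, so that it suffices to give, for each x,
    the families [loc x] that are sections near x; this makes restriction and
    gluing automatic. *)
Record localSections (O : algSheaf K X) (D : set X)
    (S : forall x, lmodType (O x)) := LocalSections {
  loc :> forall x : X, (forall y, S y) -> Prop;
  loc_ext : forall x s t, (\forall y \near x, s y = t y) -> loc x s -> loc x t;
  loc_open : forall x s, loc x s -> \forall y \near x, loc y s;
  loc_germ : forall x, D x -> forall a : S x, exists2 s, loc x s & s x = a;
  loc_eq : forall x s t, D x -> loc x s -> loc x t -> s x = t x ->
    \forall y \near x, s y = t y;
  loc0 : forall x, D x -> loc x (fun=> 0);
  locD : forall x s t, D x -> loc x s -> loc x t -> loc x (fun y => s y + t y);
  locZ : forall U x a s, D x -> open U -> U x -> asec O U a -> loc x s ->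
    loc x (fun y => a y *: s y) }.

Section ModOfLocal.
Context (O : algSheaf K X) (D : set X) (oD : open D)
  (S : forall x, lmodType (O x)) (L : localSections D S).

Definition lsec (U : set X) (s : forall x, S x) : Prop :=
  forall x, U x -> L x s.

Fact lsec_ext U s t : open U -> U `<=` D ->
  (forall x, U x -> s x = t x) -> lsec U s -> lsec U t.
Proof.
move=> oU _ st sU x Ux; apply: loc_ext (sU x Ux).
by apply: filterS (open_near oU Ux) => y /st.
Qed.

Fact lsec_res U V s : open U -> U `<=` D -> open V -> V `<=` U ->
  lsec U s -> lsec V s.
Proof. by move=> _ _ _ VU sU x /VU/sU. Qed.

Fact lsec_glue U s : open U -> U `<=` D ->
  (forall x, U x -> exists V, [/\ open V, V x, V `<=` U & lsec V s]) ->
  lsec U s.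
Proof. by move=> _ _ H x /H[V [_ Vx _]]; apply. Qed.

Fact lsec_germ x : D x -> forall a : S x,
  exists U s, [/\ open U, U x, U `<=` D, lsec U s & s x = a].
Proof.
move=> Dx a; have [s sx sa] := loc_germ L Dx a.
have [U [oU Ux UP]] := near_open (filterI (loc_open sx) (open_near oD Dx)).
by exists U, s; split=> // y /UP[].
Qed.

Fact lsec_eq U s t x : open U -> U `<=` D -> lsec U s -> lsec U t ->
  U x -> s x = t x ->
  exists V, [/\ open V, V x, V `<=` U & forall y, V y -> s y = t y].
Proof.
move=> oU UD sU tU Ux st.
have := loc_eq (UD _ Ux) (sU _ Ux) (tU _ Ux) st.
move=> /(filterI (open_near oU Ux))/near_open[V [oV Vx VP]].
by exists V; split=> // y /VP[].
Qed.

Definition mod_of_local : modSheaf O D.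
Proof.
apply: (@ModSheaf K X O D S
  (SheafOn lsec_ext lsec_res lsec_glue lsec_germ lsec_eq)).
- by move=> U _ UD x /UD; exact: loc0.
- move=> U s t _ UD sU tU x Ux.
  by apply: locD; [exact: UD | exact: sU | exact: tU].
- by move=> U a s oU UD aU sU x Ux; apply: locZ (aU) (sU _ Ux) => //; exact: UD.
Defined.

End ModOfLocal.
End LocalSections.

(** * Finite presentations *)

Section Presentations.
Context (K : comNzRingType) (X : topologicalType) (O : algSheaf K X).

Definition hom_res P Q D1 D2 (B1 : modSheaf O D1) (B2 : modSheaf O D2)
    (QP : Q `<=` P) (g : modHom P B1 B2) : modHom Q B1 B2 :=
  ModHom (hmap := g)
    (fun U s oU UQ sU => hmap_sec g oU (subset_trans UQ QP) sU).

Definition hom_id P D (B : modSheaf O D) : modHom P B B :=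
  ModHom (hmap := fun x => idfun : {linear B x -> B x})
    (fun U s oU UP sU => sU).

Lemma msec_sum D (B : modSheaf O D) U (I : Type) (r : seq I)
    (F : I -> forall x, B x) : open U -> U `<=` D ->
  (forall i, msec B U (F i)) -> msec B U (fun x => \sum_(i <- r) F i x).
Proof.
move=> oU UD FU; elim: r => [|i r IH].
  by apply: sec_ext (msec0 B oU UD) => // x _; rewrite big_nil.
by apply: sec_ext (msecD oU UD (FU i) IH) => // x _; rewrite big_cons.
Qed.

Lemma msec_lincomb D (B : modSheaf O D) U l (b : forall x, 'I_l -> B x)
    (a : forall x, 'rV[O x]_l) : open U -> U `<=` D ->
  (forall i, msec B U (fun x => b x i)) -> fsec U a ->
  msec B U (fun x => lincomb (b x) (a x)).
Proof.
move=> oU UD bU aU; apply: msec_sum => // i; apply: msecZ => //; exact: aU.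
Qed.

Lemma fsec_mul U k l (c : forall x, 'rV[O x]_k) (r : forall x, 'M[O x]_(k, l)) :
  open U -> fsec U c -> (forall j i, asec O U (fun x => r x j i)) ->
  fsec U (fun x => c x *m r x).
Proof.
move=> oU cU rU.
have H := @msec_lincomb setT (free_mod O l) U k (fun x j => row j (r x)) c oU.
apply: (@sec_ext _ _ _ (msec (free_mod O l)) _
  (fun x => lincomb (fun j => row j (r x)) (c x))) => //.
  by move=> x _; rewrite /lincomb -mulmx_sum_row.
apply: H => // j i; apply: sec_ext (rU j i) => // x _.
by rewrite mxE.
Qed.

Lemma fsec_delta U l (i : 'I_l) : open U ->
  fsec U (fun x => delta_mx ord0 i : 'rV[O x]_l).
Proof.
move=> oU j; case: (eqVneq j i) => ji.
  by apply: sec_ext (asec1 O oU) => // x _; rewrite mxE ji !eqxx.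
apply: sec_ext (fsec0 O (k := l) oU (fun _ _ => I) j) => // x _.
by rewrite !mxE (negPf ji) andbF.
Qed.

Lemma msec_eq_near D (B : modSheaf O D) U V s t x : open U -> open V ->
  U `<=` D -> V `<=` D -> msec B U s -> msec B V t -> U x -> V x -> s x = t x ->
  \forall y \near x, s y = t y.
Proof.
move=> oU oV UD VD sU tV Ux Vx st.
have oW : open (U `&` V) by exact: openI.
have WD : U `&` V `<=` D by move=> y [/UD].
have [W [oW' Wx _ WP]] := sec_eq oW WD
  (sec_res oU UD oW (@subIsetl _ _ _) sU)
  (sec_res oV VD oW (@subIsetr _ _ _) tV)
  (conj Ux Vx) st.
exact: filterS WP (open_near oW' Wx).
Qed.

(** The exactness of O^k -> O^l -> B -> 0 over U in coordinates: the rows of the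
    matrices [r x] are the relations between the generators [b x]. *)
Record presented D (B : modSheaf O D) (U : set X) k l
    (r : forall x, 'M[O x]_(k, l)) (b : forall x, 'I_l -> B x) : Prop :=
  Presented {
  pres_open : open U;
  pres_sub : U `<=` D;
  pres_rel_sec : forall j i, asec O U (fun x => r x j i);
  pres_gen_sec : forall i, msec B U (fun x => b x i);
  pres_gen : forall x, U x -> forall m, exists a, lincomb (b x) a = m;
  pres_rel : forall x, U x -> forall a,
    lincomb (b x) a = 0 <-> exists c, c *m r x = a }.

Lemma presented_res D (B : modSheaf O D) U V k l
    (r : forall x, 'M[O x]_(k, l)) (b : forall x, 'I_l -> B x) :
  open V -> V `<=` U -> presented U r b -> presented V r b.
Proof.
move=> oV VU [oU UD rU bU gU eU]; split=> //.
- exact: subset_trans VU UD.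
- by move=> j i; apply: sec_res (rU j i).
- by move=> i; apply: sec_res (bU i).
- by move=> x /VU/gU.
- by move=> x /VU/eU.
Qed.

Lemma coherent_presented D (B : modSheaf O D) x : coherent B -> D x ->
  exists U k l (r : forall x, 'M[O x]_(k, l)) (b : forall x, 'I_l -> B x),
    U x /\ presented U r b.
Proof.
move=> cB /cB[U [oU Ux UD [k [l [u [v uv]]]]]].
pose r y : 'M[O y]_(k, l) :=
  \matrix_(j, i) (u y (delta_mx ord0 j : 'rV_k) : 'rV_l) ord0 i.
exists U, k, l, r, (fun x i => v x (delta_mx ord0 i : 'rV_l)); split=> //.
have uE y (c : 'rV_k) : c *m r y = u y c.
  rewrite [RHS]linear_rowE /lincomb mulmx_sum_row; apply: eq_bigr => j _.
  by congr (_ *: _); apply/rowP => i; rewrite !mxE.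
have vE y (a : 'rV_l) :
    lincomb (fun i => v y (delta_mx ord0 i : 'rV_l)) a = v y a.
  exact/esym/(@linear_rowE _ _ _ (v y)).
split=> //.
- move=> j i; have H := hmap_sec u oU (@subset_refl _ _) (fsec_delta j oU).
  by apply: sec_ext (H i) => // y _; rewrite mxE.
- by move=> i; apply: (hmap_sec v oU (@subset_refl _ _)); exact: fsec_delta.
- by move=> y Uy m; have [H _] := uv y Uy; have [a <-] := H m; exists a.
- move=> y Uy a; rewrite vE; have [_ ->] := uv y Uy.
  by split=> -[c <-]; exists c; rewrite uE.
Qed.

Lemma presented_coherent D (B : modSheaf O D) :
  (forall x, D x -> exists U k l (r : forall x, 'M[O x]_(k, l))
      (b : forall x, 'I_l -> B x), U x /\ presented U r b) -> coherent B.
Proof.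
move=> H x /H[U [k [l [r [b [Ux [oU UD rU bU gU eU]]]]]]].
exists U; split=> //; exists k, l.
unshelve eexists (@ModHom _ _ _ U _ _ (free_mod O k) (free_mod O l)
  (fun x => mulmxr (r x)) _).
  by move=> V s oV VU sV; apply: fsec_mul => // j i; apply: sec_res (rU j i).
unshelve eexists (@ModHom _ _ _ U _ _ (free_mod O l) B
  (fun x => lincomb (b x)) _).
  move=> V s oV VU sV; apply: msec_lincomb => //; first exact: subset_trans UD.
  by move=> i; apply: sec_res (bU i).
by move=> y Uy; split; [exact: gU | exact: eU].
Qed.

(** The coefficients of the germ at x extend to sections near x, and the
    combination of the generators that they define agrees with s at x, hence
    near x. *)
Lemma presented_lift D (B : modSheaf O D) U k l
    (r : forall x, 'M[O x]_(k, l)) (b : forall x, 'I_l -> B x) V s x :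
  presented U r b -> open V -> V `<=` D -> msec B V s -> V x -> U x ->
  exists W (a : forall x, 'rV[O x]_l),
    [/\ open W, W x, W `<=` U `&` V, fsec W a &
    forall y, W y -> s y = lincomb (b y) (a y)].
Proof.
move=> [oU UD rU bU gU eU] oV VD sV Vx Ux.
have [a0 a0E] := gU x Ux (s x).
have [W [a [oW Wx _ aW ax]]] := fsec_germ (k := l) I a0.
have oWU : open (W `&` U) by exact: openI.
have WUD : W `&` U `<=` D by move=> y [_ /UD].
have aWU : fsec (W `&` U) a by apply: fsec_res (aW).
have abW : msec B (W `&` U) (fun y => lincomb (b y) (a y)).
  by apply: msec_lincomb => // i; apply: sec_res (bU i).
have := msec_eq_near oV oWU VD WUD sV abW Vx (conj Wx Ux).
rewrite ax => /(_ (esym a0E)).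
move=> /(filterI (filterI (open_near oWU (conj Wx Ux)) (open_near oV Vx))).
move=> /near_open[W' [oW' W'x W'P]]; exists W', a; split=> //.
- by move=> y /W'P[[[_ ? ?]]].
- by apply: fsec_res (aWU) => // y /W'P[[]].
- by move=> y /W'P[].
Qed.

(** On stalks, linear combinations of relations are all that has to be sent to
    zero, by exactness; sections go to sections because they are locally
    combinations of generators with sections of O as coefficients. *)
Lemma hom_of_presented D1 D2 (B1 : modSheaf O D1) (B2 : modSheaf O D2) U k l
    (r : forall x, 'M[O x]_(k, l)) (b : forall x, 'I_l -> B1 x)
    (t : forall x, 'I_l -> B2 x) :
  presented U r b -> U `<=` D2 -> (forall i, msec B2 U (fun x => t x i)) ->
  (forall x, U x -> forall j, lincomb (t x) (row j (r x)) = 0) ->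
  exists Phi : modHom U B1 B2, forall x, U x -> forall i, Phi x (b x i) = t x i.
Proof.
move=> pU UD2 tU rt; have [oU UD rU bU gU eU] := pU.
have H x : exists g : {linear B1 x -> B2 x}, U x ->
    forall a, g (lincomb (b x) a) = lincomb (t x) a.
  have [Ux|nUx] := pselect (U x); last by exists \0.
  have [|a /(eU x Ux)[c <-]|g gE] :=
    @linear_factor _ _ _ _ (lincomb (b x)) (lincomb (t x)).
  - exact: gU.
  - by rewrite /= lincomb_mul [LHS]big1 // => j _; rewrite rt // scaler0.
  - by exists g.
pose g x := projT1 (cid (H x)).
have gE x : U x -> forall a, g x (lincomb (b x) a) = lincomb (t x) a.
  exact: projT2 (cid (H x)).
unshelve eexists (@ModHom _ _ _ U _ _ B1 B2 g _).
  move=> V s oV VU sV; apply: sec_near => //; first exact: subset_trans UD2.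
  move=> x Vx; have [|W [a [oW Wx WUV aW sa]]] :=
    presented_lift pU oV _ sV Vx (VU _ Vx).
    exact: subset_trans UD.
  exists W, (fun y => lincomb (t y) (a y)); split=> //.
  - by move=> y /WUV[/UD2].
  - apply: msec_lincomb => //; first by move=> y /WUV[/UD2].
    by move=> i; apply: sec_res (tU i) => // y /WUV[].
  - by apply: filterS (open_near oW Wx) => y Wy; rewrite sa // gE //;
      have [] := WUV _ Wy.
by move=> x Ux i; rewrite -{1}(lincomb_delta (b x)) /= gE // lincomb_delta.
Qed.

(** The images of finitely many generators are sections that agree at x, hence
    on a common neighbourhood of x. *)
Lemma hom_eq_near D1 D2 (B1 : modSheaf O D1) (B2 : modSheaf O D2)
    P Q (f : modHom P B1 B2) (g : modHom Q B1 B2) x :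
  coherent B1 -> D1 x -> P `<=` D2 -> Q `<=` D2 ->
  open P -> open Q -> P x -> Q x -> f x =1 g x ->
  \forall y \near x, f y =1 g y.
Proof.
move=> cB Dx PD QD oP oQ Px Qx fg.
have [U [k [l [r [b [Ux pU]]]]]] := coherent_presented cB Dx.
have [oU UD _ bU gU _] := pU.
have oPU : open (P `&` U) by exact: openI.
have oQU : open (Q `&` U) by exact: openI.
have : \forall y \near x, forall i, f y (b y i) = g y (b y i).
  apply: filter_forall => i.
  apply: (@msec_eq_near D2 B2 (P `&` U) (Q `&` U)) => //.
  - by move=> y [/PD].
  - by move=> y [/QD].
  - by apply: hmap_sec => //; apply: sec_res (bU i) => // y [].
  - by apply: hmap_sec => //; apply: sec_res (bU i) => // y [].
move=> /(filterI (open_near oU Ux)); apply: filterS => y [Uy fgy] m.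
have [a <-] := gU y Uy m; rewrite !linear_lincomb.
by apply: eq_bigr => i _; rewrite fgy.
Qed.

(** The inverse on stalks preserves sections: the preimage of the germ of a
    section s extends to a section, whose image agrees with s near the point. *)
Lemma iso_of_bij D1 D2 (B1 : modSheaf O D1) (B2 : modSheaf O D2) P
    (h : modHom P B1 B2) : P `<=` D1 -> P `<=` D2 ->
  (forall x, P x -> forall b, exists a, h x a = b) ->
  (forall x, P x -> forall a, h x a = 0 -> a = 0) ->
  exists g : modIso P B1 B2, iso_hom g = h.
Proof.
move=> PD1 PD2 hsurj hinj.
have H x : exists g : {linear B2 x -> B1 x}, P x -> forall a, g (h x a) = a.
  have [Px|nPx] := pselect (P x); last by exists \0.
  have [||g gE] := @linear_factor _ _ _ _ (h x) idfun; first exact: hsurj.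
    by move=> a /hinj; apply.
  by exists g.
pose g x := projT1 (cid (H x)).
have gK x : P x -> forall a, g x (h x a) = a by exact: projT2 (cid (H x)).
have hK x : P x -> cancel (g x) (h x).
  by move=> Px a; have [c <-] := hsurj _ Px a; rewrite gK.
have gsec U s : open U -> U `<=` P -> msec B2 U s ->
    msec B1 U (fun x => g x (s x)).
  move=> oU UP sU; apply: sec_near => //; first exact: subset_trans PD1.
  move=> x Ux; have [V [t [oV Vx VD tV tx]]] :=
    sec_germ (msec B1) (PD1 _ (UP _ Ux)) (g x (s x)).
  have oW : open (V `&` U) by exact: openI.
  exists V, t; split=> //.
  have : \forall y \near x, s y = h y (t y).
    apply: (@msec_eq_near D2 B2 U (V `&` U)) => //.
    - by move=> y /UP/PD2.
    - by move=> y [_ /UP/PD2].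
    - apply: hmap_sec => //; first by move=> y [_ /UP].
      by apply: sec_res tV.
    - rewrite tx; have [a <-] := hsurj _ (UP _ Ux) (s x).
      by rewrite gK //; exact: UP.
  apply: filterS2 (open_near oU Ux) => y Uy ->; rewrite gK //; exact: UP.
by exists (@ModIso _ _ _ P _ _ B1 B2 h (ModHom gsec) gK hK).
Qed.

Lemma presented_iso D1 D2 (B1 : modSheaf O D1) (B2 : modSheaf O D2) U k l
    (r : forall x, 'M[O x]_(k, l)) (b : forall x, 'I_l -> B1 x) P
    (h : modIso P B1 B2) :
  presented U r b -> U `<=` P -> U `<=` D2 ->
  presented U r (fun x i => h x (b x i)).
Proof.
move=> [oU UD rU bU gU eU] UP UD2; split=> //.
- by move=> i; apply: hmap_sec.
- move=> x Ux m; have [a aE] := gU x Ux (iso_inv h x m).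
  by exists a; rewrite -linear_lincomb aE iso_invK //; exact: UP.
- move=> x Ux a; rewrite -eU // -linear_lincomb.
  split=> [|->]; last by rewrite linear0.
  move=> /(congr1 (iso_inv h x)).
  by rewrite linear0 iso_homK //; exact: UP.
Qed.

(** The module with prescribed relations r: its sections are locally the classes
    of sections of O^l. A section of O^l that at a point is a combination of
    relations is one nearby, with the coefficients extended to sections. *)
Section CokerSheaf.
Context (U : set X) (oU : open U) (k l : nat) (r : forall x, 'M[O x]_(k, l)).
Hypothesis rU : forall j i, asec O U (fun x => r x j i).

Let S x : lmodType (O x) := coker (mulmxr (r x) : {linear 'rV_k -> 'rV_l}).
Let p x : {linear 'rV_l -> S x} := coker_pi (mulmxr (r x)).

Definition coker_loc x (s : forall y, S y) : Prop :=
  exists V (a : forall y, 'rV[O y]_l),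
    [/\ open V, V x, fsec V a & forall y, V y -> s y = p y (a y)].

Fact coker_loc_ext x s t :
  (\forall y \near x, s y = t y) -> coker_loc x s -> coker_loc x t.
Proof.
move=> st [V [a [oV Vx aV sa]]].
have [W [oW Wx WP]] := near_open (filterI st (open_near oV Vx)).
exists W, a; split=> //; first by apply: fsec_res (aV) => // y /WP[].
by move=> y /WP[<-]; exact: sa.
Qed.

Fact coker_loc_open x s : coker_loc x s -> \forall y \near x, coker_loc y s.
Proof.
move=> [V [a [oV Vx aV sa]]]; apply: filterS (open_near oV Vx) => y Vy.
by exists V, a.
Qed.

Fact coker_loc_germ x : U x ->
  forall a : S x, exists2 s, coker_loc x s & s x = a.
Proof.
move=> _ a; have [a0 <-] := coker_pi_surj a.
have [V [a' [oV Vx _ aV <-]]] := fsec_germ (k := l) (x := x) I a0.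
by exists (fun y => p y (a' y)) => //; exists V, a'.
Qed.

Fact coker_loc2 x s t : coker_loc x s -> coker_loc x t ->
  exists V a b, [/\ open V, V x, fsec V a, fsec V b &
    forall y, V y -> s y = p y (a y) /\ t y = p y (b y)].
Proof.
move=> [V [a [oV Vx aV sa]]] [W [b [oW Wx bW tb]]].
have oVW : open (V `&` W) by exact: openI.
exists (V `&` W), a, b; split=> //.
- by apply: fsec_res (aV).
- by apply: fsec_res (bW).
- by move=> y [Vy Wy]; rewrite sa ?tb.
Qed.

Fact coker_loc_eq x s t : U x -> coker_loc x s -> coker_loc x t -> s x = t x ->
    \forall y \near x, s y = t y.
Proof.
move=> Ux sx tx st; have [V [a [b [oV Vx aV bV ab]]]] := coker_loc2 sx tx.
move: st; have [-> ->] := ab x Vx; move=> /coker_pi_eq[c0 /= abc].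
have [W [c [oW Wx _ cW cx]]] := fsec_germ (k := k) (x := x) I c0.
have oWU : open (W `&` U) by exact: openI.
have cWU : fsec (W `&` U) c by apply: fsec_res (cW).
have crU : fsec (W `&` U) (fun y => c y *m r y).
  by apply: fsec_mul => // j i; apply: sec_res (rU j i).
have oWV : open ((W `&` U) `&` V) by exact: openI.
have e : \forall y \near x, a y = c y *m r y + b y.
  apply: (@msec_eq_near setT (free_mod O l) V ((W `&` U) `&` V)) => //.
  - apply: fsecD => //; first by apply: fsec_res (crU).
    by apply: fsec_res (bV).
  - by rewrite cx -abc subrK.
apply: filterS2 e (open_near oV Vx) => y ey Vy; have [-> ->] := ab y Vy.
by apply/coker_pi_eq; exists (c y); rewrite ey addrK.
Qed.

Fact coker_loc0 x : U x -> coker_loc x (fun=> 0).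
Proof.
move=> _; exists setT, (fun=> 0); split=> //; first exact: openT.
by apply: fsec0 => //; exact: openT.
Qed.

Fact coker_locD x s t : U x -> coker_loc x s -> coker_loc x t ->
  coker_loc x (fun y => s y + t y).
Proof.
move=> Ux sx tx; have [V [a [b [oV Vx aV bV ab]]]] := coker_loc2 sx tx.
exists V, (fun y => a y + b y); split=> //; first exact: fsecD.
by move=> y /ab[-> ->]; rewrite linearD.
Qed.

Fact coker_locZ W x a s : U x -> open W -> W x -> asec O W a -> coker_loc x s ->
  coker_loc x (fun y => a y *: s y).
Proof.
move=> Ux oW Wx aW [V [b [oV Vx bV sb]]].
have oVW : open (V `&` W) by exact: openI.
exists (V `&` W), (fun y => a y *: b y); split=> //.
  by apply: fsecZ => //; [apply: sec_res aW | apply: fsec_res (bV)].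
by move=> y [/sb -> _]; rewrite linearZ.
Qed.

Definition coker_mod : modSheaf O U := mod_of_local oU
  (LocalSections coker_loc_ext coker_loc_open coker_loc_germ coker_loc_eq
     coker_loc0 coker_locD coker_locZ).

Lemma coker_mod_presented :
  @presented U coker_mod U k l r (fun x i => p x (delta_mx ord0 i)).
Proof.
have E x a : lincomb (fun i => p x (delta_mx ord0 i)) a = p x a.
  by rewrite -linear_rowE.
split=> //.
- move=> i x Ux; exists U, (fun y => delta_mx ord0 i); split=> //.
  exact: fsec_delta.
- by move=> x Ux m; have [a <-] := coker_pi_surj m; exists a; rewrite E.
- by move=> x Ux a; rewrite E; exact: (coker_pi_eq0 (mulmxr (r x))).
Qed.

End CokerSheaf.
End Presentations.

(** * Shrinking open covers *)

Section Paracompact.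
Context (X : topologicalType).

Lemma near_finite (I : Type) (A : set I) (P : I -> X -> Prop) (p : X) :
  finite_set A -> (forall i, A i -> \forall q \near p, P i q) ->
  \forall q \near p, forall i, A i -> P i q.
Proof.
move=> fA AP; have /finite_seqP[s As] : finite_set (A : set {classic I}) := fA.
suff : \forall q \near p, forall i : {classic I}, i \in s -> P i q.
  by apply: filterS => q Pq i; rewrite As => /Pq.
have : forall i : {classic I}, i \in s -> A i by rewrite As.
elim: s {As} => [_|i s IH sA]; first exact: nearW.
have Pi := AP i (sA i (mem_head i s)).
have /IH : forall j : {classic I}, j \in s -> A j.
  by move=> j js; apply: sA; rewrite inE js orbT.
by apply: filterS2 Pi => q Piq Pq j; rewrite inE => /predU1P[->|/Pq].
Qed.

Definition locally_finite (B : set (set X)) := forall x : X,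
  exists2 W : set X, nbhs x W & finite_set [set V | B V /\ V `&` W !=set0].

(** Only finitely many members of B meet a given neighbourhood W of p, and W can
    be made smaller so as to avoid the closures of those among them whose
    closure does not contain p. *)
Lemma locally_finite_closure (B : set (set X)) (p : X) : locally_finite B ->
  finite_set [set b | B b /\ closure b p] /\
  \forall q \near p, forall b, B b -> closure b q -> closure b p.
Proof.
move=> /(_ p)[W nW fW]; split.
  by apply: sub_finite_set fW => b [Bb]; move=> /(_ W nW); split.
have H : \forall q \near p, forall b, B b /\ b `&` W !=set0 ->
    closure b q -> closure b p.
  apply: near_finite fW _ => b _; have [bp|nbp] := pselect (closure b p).
    exact: nearW.
  have := open_near (closed_openC (@closed_closure _ b)) nbp.
  by apply: filterS => q nbq.
move: (nbhs_interior nW); apply: filterS2 H => q H Wq b Bb bq.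
by apply: H => //; split=> //; exact: bq.
Qed.

Hypotheses (hX : hausdorff_space X) (pX : paracompact X).

(** Refine, locally finitely, the cover by V and the open sets whose closure
    misses x. By local finiteness x has a neighbourhood U that misses all
    members of the refinement whose closure does not contain x; a point of the
    closure of U lies in a member that meets U, hence in one contained in V. *)
Lemma paracompact_regular x (V : set X) : open V -> V x ->
  exists U, [/\ open U, U x & closure U `<=` V].
Proof.
move=> oV Vx; pose A := [set W : set X | open W /\ (W = V \/ ~ closure W x)].
have [| |B [oB cB BA fB]] := @pX A; first by move=> W [].
  apply/seteqP; split=> // y _; have [Vy|nVy] := pselect (V y).
    by exists V => //; split=> //; left.
  have xy : x != y by apply/eqP => xy; apply: nVy; rewrite -xy.
  move: hX; rewrite open_hausdorff => /(_ x y xy).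
  move=> [[P Q] /= [xP yQ] [oP oQ /eqP PQ]].
  exists Q; last exact: set_mem; split=> //; right=> /(_ P) H.
  have [|z [Qz Pz]] := H.
    by apply: open_nbhs_nbhs; split=> //; exact: set_mem.
  by have : (P `&` Q) z by []; rewrite PQ.
have [_ /near_open[U [oU Ux UP]]] := locally_finite_closure x fB.
exists U; split=> // z clz.
have : [set: X] z by []. rewrite -cB => -[b Bb bz].
have [|w [Uw bw]] := clz b; first by apply: open_near => //; exact: oB.
have bx := UP _ Uw _ Bb (subset_closure bw).
have [W [_ [->|nWx]] bW] := BA _ Bb; first exact: bW.
by exfalso; apply: nWx; exact: closure_subset bW _ bx.
Qed.

(** Take a locally finite open cover in which every member that meets Z has its
    closure inside some V_i, assign to such a member one of these i, and let K_i
    be the union of the closures of the members assigned to i. The K_i are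
    finite in number at each point p, and near p no other K_i occurs: so
    conditions that hold near p for each i with p in K_i hold, on one
    neighbourhood, for all the indices in use. *)
Lemma paracompact_shrinking (I : Type) (Z : set X) (V : I -> set X) :
  closed Z ->
  (forall i, open (V i)) -> (forall z, Z z -> exists i, V i z) ->
  exists K : I -> set X, [/\ forall i, K i `<=` V i,
    forall p, finite_set [set i | K i p],
    forall p, \forall q \near p, forall i, K i q -> K i p &
    forall p, Z p -> \forall q \near p, exists i, K i q].
Proof.
move=> cZ oV ZV.
pose A := [set U : set X | open U /\
  (U `&` Z = set0 \/ exists i, closure U `<=` V i)].
have [| |B [oB cB BA fB]] := @pX A; first by move=> W [].
  apply/seteqP; split=> // y _; have [Zy|nZy] := pselect (Z y).
    have [i Viy] := ZV y Zy.
    have [U [oU Uy UV]] := paracompact_regular (oV i) Viy.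
    by exists U => //; split=> //; right; exists i.
  exists (~` Z) => //; split; first exact: closed_openC.
  by left; rewrite setICl.
pose good (b : set X) := exists i, closure b `<=` V i.
pose K i p :=
  exists b (gb : good b), [/\ B b, projT1 (cid gb) = i & closure b p].
have near1 b p : B b -> b p -> \forall q \near p, b q.
  by move=> Bb bp; apply: open_near => //; exact: oB.
exists K; split.
- by move=> i p [b [gb [Bb <- bp]]]; exact: (projT2 (cid gb)).
- move=> p; have [fp _] := locally_finite_closure p fB.
  have : finite_set ((fun b => if pselect (good b) is left gb
      then Some (projT1 (cid gb)) else None) @` [set b | B b /\ closure b p]).
    exact: finite_image.
  move=> /(@finite_preimage _ _ _ (@Some I)) H.
  apply: sub_finite_set (H _); last by move=> i j _ _ [].
  move=> i [b [gb [Bb bi bp]]]; exists b => //; case: pselect => // gb'.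
  by rewrite (Prop_irrelevance gb' gb) bi.
- move=> p; have [_ H] := locally_finite_closure p fB.
  apply: filterS H => q H i [b [gb [Bb bi bq]]].
  by exists b, gb; split=> //; exact: H bq.
- move=> p Zp; have : [set: X] p by []. rewrite -cB => -[b Bb bp].
  have gb : good b.
    have [W [_ [WZ|[i Wi]] bW]] := BA _ Bb.
      by have : (W `&` Z) p by [split=> //; exact: bW]; rewrite WZ.
    by exists i; exact: subset_trans (closure_subset bW) Wi.
  apply: filterS (near1 _ _ Bb bp) => q bq.
  by exists (projT1 (cid gb)), b, gb; split=> //; exact: subset_closure.
Qed.

End Paracompact.

(** * Gluing modules *)

(** Modules F_i on open sets V_i are glued along homomorphisms Phi_ij over the
    union N of the open sets W_t; the indices in [A t] are those available on
    W_t, where the Phi_ij satisfy the cocycle identities. As a stalk of the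
    glued module at q one may take that of F_i for any index i available near
    q; the choice made is [idx q]. *)
Section Glue.
Context (K : comNzRingType) (X : topologicalType) (O : algSheaf K X).
Context (I T : Type) (V : I -> set X) (F : forall i, modSheaf O (V i)).
Context (W : T -> set X) (A : T -> I -> Prop) (idx : X -> I).
Context (Phi : forall i j x, {linear F i x -> F j x}).
Hypothesis oW : forall t, open (W t).
Hypothesis WV : forall t i, A t i -> W t `<=` V i.
Hypothesis idxA : forall t x, W t x -> A t (idx x).
Hypothesis Phi_sec : forall t i j U s, A t i -> A t j -> open U -> U `<=` W t ->
  msec (F i) U s -> msec (F j) U (fun x => Phi i j x (s x)).
Hypothesis Phi_comp : forall t i j k x, A t i -> A t j -> A t k -> W t x ->
  forall a, Phi j k x (Phi i j x a) = Phi i k x a.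
Hypothesis Phi_id : forall t i x, A t i -> W t x -> forall a, Phi i i x a = a.

Let N := \bigcup_t W t.
Let S x : lmodType (O x) := F (idx x) x.

Definition glue_in i (U : set X) (s : forall x, S x) : Prop :=
  exists2 s0, msec (F i) U s0 & forall q, U q -> s q = Phi i (idx q) q (s0 q).

Definition glue_loc x (s : forall x, S x) : Prop :=
  exists t i U, [/\ open U, U x, U `<=` W t, A t i & glue_in i U s].

(** A section near x that comes from F_i' on W_t' comes from F_i on any W_t that
    contains x and has i available: pass from i' to [idx x] by the cocycle on
    W_t', and from [idx x], available on both, to i by the cocycle on W_t. *)
Lemma glue_rechart x s t i : glue_loc x s -> W t x -> A t i ->
  exists U, [/\ open U, U x, U `<=` W t & glue_in i U s].
Proof.
move=> [t' [i' [U [oU Ux UW ti [s' s'U ss']]]]] Wx Ai.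
have oUW : open (U `&` W t) by exact: openI.
have UV : U `<=` V i' := subset_trans UW (WV ti).
have Wx' := UW _ Ux.
exists (U `&` W t); split=> //.
exists (fun q => Phi (idx x) i q (Phi i' (idx x) q (s' q))).
  apply: (@Phi_sec t) => //; first exact: idxA.
  apply: (@Phi_sec t') => //; first exact: idxA.
    by move=> q [/UW].
  by apply: sec_res s'U.
move=> q [Uq Wq]; have Wq' := UW _ Uq.
rewrite (@Phi_comp t) //; try exact: idxA.
by rewrite (@Phi_comp t') ?ss' //; exact: idxA.
Qed.

Fact glue_loc_ext x s t :
  (\forall y \near x, s y = t y) -> glue_loc x s -> glue_loc x t.
Proof.
move=> st [k [i [U [oU Ux UW ki [s' s'U ss']]]]].
have [P [oP Px PP]] := near_open (filterI st (open_near oU Ux)).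
exists k, i, P; split=> //; first by move=> y /PP[_ /UW].
exists s'.
  apply: (sec_res oU) s'U => //; first exact: subset_trans UW (WV ki).
  by move=> y /PP[].
by move=> q /PP[<-]; exact: ss'.
Qed.

Fact glue_loc_open x s : glue_loc x s -> \forall y \near x, glue_loc y s.
Proof.
move=> [k [i [U [oU Ux UW ki sU]]]]; apply: filterS (open_near oU Ux) => y Uy.
by exists k, i, U.
Qed.

Fact glue_loc_germ x : N x -> forall a : S x, exists2 s, glue_loc x s & s x = a.
Proof.
move=> [t _ Wx] a.
have [U [s [oU Ux UV sU sx]]] :=
  sec_germ (msec (F (idx x))) (WV (idxA Wx) Wx) a.
exists (fun q => Phi (idx x) (idx q) q (s q)).
  have oUW : open (U `&` W t) by exact: openI.
  exists t, (idx x), (U `&` W t); split=> //; first exact: idxA.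
  by exists s => //; apply: sec_res sU.
by rewrite (Phi_id (idxA Wx) Wx).
Qed.

Lemma glue_loc2 x s t : N x -> glue_loc x s -> glue_loc x t ->
  exists k U, [/\ open U, U x, U `<=` W k, glue_in (idx x) U s &
    glue_in (idx x) U t].
Proof.
move=> [k _ Wx] sx tx.
have [U [oU Ux UW [s' s'U ss']]] := glue_rechart sx Wx (idxA Wx).
have [U' [oU' U'x U'W [t' t'U tt']]] := glue_rechart tx Wx (idxA Wx).
have oUU : open (U `&` U') by exact: openI.
have WVx : W k `<=` V (idx x) := WV (idxA Wx).
exists k, (U `&` U'); split=> //; first by move=> q [/UW].
- exists s'; last by move=> q [/ss'].
  by apply: sec_res s'U => //; exact: subset_trans WVx.
- exists t'; last by move=> q [_ /tt'].
  by apply: sec_res t'U => //; exact: subset_trans WVx.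
Qed.

Fact glue_loc_eq x s t : N x -> glue_loc x s -> glue_loc x t -> s x = t x ->
  \forall y \near x, s y = t y.
Proof.
move=> Nx sx tx.
have [k [U [oU Ux UW [s' s'U ss'] [t' t'U tt']]]] := glue_loc2 Nx sx tx.
have Wx := UW _ Ux; have Ax := idxA Wx.
rewrite ss' // tt' // !(Phi_id Ax Wx) => st.
have UV : U `<=` V (idx x) := subset_trans UW (WV Ax).
have := msec_eq_near oU oU UV UV s'U t'U Ux Ux st.
by apply: filterS2 (open_near oU Ux) => y Uy e; rewrite ss' // tt' // e.
Qed.

Fact glue_loc0 x : N x -> glue_loc x (fun=> 0).
Proof.
move=> [t _ Wx]; have Ax := idxA Wx.
exists t, (idx x), (W t); split=> //.
exists (fun=> 0); first by apply: msec0 => //; exact: WV.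
by move=> q _; rewrite linear0.
Qed.

Fact glue_locD x s t : N x -> glue_loc x s -> glue_loc x t ->
  glue_loc x (fun y => s y + t y).
Proof.
move=> Nx sx tx.
have [k [U [oU Ux UW [s' s'U ss'] [t' t'U tt']]]] := glue_loc2 Nx sx tx.
have Ax := idxA (UW _ Ux).
exists k, (idx x), U; split=> //; exists (fun y => s' y + t' y).
  by apply: msecD => //; exact: subset_trans UW (WV Ax).
by move=> q Uq; rewrite linearD ss' ?tt'.
Qed.

Fact glue_locZ P x a s : N x -> open P -> P x -> asec O P a -> glue_loc x s ->
  glue_loc x (fun y => a y *: s y).
Proof.
move=> Nx oP Px aP sx.
have [k [U [oU Ux UW [s' s'U ss'] _]]] := glue_loc2 Nx sx sx.
have Ax := idxA (UW _ Ux).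
have oUP : open (U `&` P) by exact: openI.
have UV : U `<=` V (idx x) := subset_trans UW (WV Ax).
exists k, (idx x), (U `&` P); split=> //; first by move=> q [/UW].
exists (fun y => a y *: s' y).
  apply: msecZ => //; first by move=> q [/UV].
    by apply: sec_res aP.
  by apply: sec_res s'U.
by move=> q [Uq _]; rewrite linearZ ss'.
Qed.

Definition glue_mod : modSheaf O N :=
  mod_of_local (bigcup_open (fun t _ => oW t))
  (LocalSections glue_loc_ext glue_loc_open glue_loc_germ glue_loc_eq
     glue_loc0 glue_locD glue_locZ).

(** The stalk of the glued module at x is that of F_j with j = [idx x], so the
    isomorphism with F_i is Phi_ij there. *)
Lemma glue_iso t i : A t i -> exists g : modIso (W t) (F i) glue_mod,
  forall x, g x = Phi i (idx x) x /\ iso_inv g x = Phi (idx x) i x.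
Proof.
move=> ti.
have hsec U s : open U -> U `<=` W t -> msec (F i) U s ->
    msec glue_mod U (fun x => Phi i (idx x) x (s x)).
  by move=> oU UW sU x Ux; exists t, i, U; split=> //; exists s.
have gsec U s : open U -> U `<=` W t -> msec glue_mod U s ->
    msec (F i) U (fun x => Phi (idx x) i x (s x)).
  move=> oU UW sU; have WVi := WV ti.
  apply: sec_near => // [|x Ux]; first exact: subset_trans WVi.
  have [P [oP Px PW [s0 s0P ss0]]] := glue_rechart (sU _ Ux) (UW _ Ux) ti.
  exists P, s0; split=> //; first exact: subset_trans WVi.
  apply: filterS (open_near oP Px) => q Pq; rewrite ss0 //.
  have Wq := PW _ Pq; have Aq := idxA Wq.
  by rewrite (Phi_comp ti Aq ti Wq) (Phi_id ti Wq).
unshelve eexists (@ModIso _ _ _ (W t) _ _ (F i) glue_mod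
  (@ModHom _ _ _ _ _ _ (F i) glue_mod (fun x => Phi i (idx x) x) hsec)
  (@ModHom _ _ _ _ _ _ glue_mod (F i)
     (fun x => Phi (idx x) i x) gsec) _ _) => //.
- move=> x Wx a; have Ax := idxA Wx.
  exact: etrans (Phi_comp ti Ax ti Wx _) (Phi_id ti Wx _).
- move=> x Wx a; have Ax := idxA Wx.
  exact: etrans (Phi_comp Ax ti Ax Wx _) (Phi_id Ax Wx _).
Qed.

Lemma glue_coherent : (forall i, coherent (F i)) -> coherent glue_mod.
Proof.
move=> cF; apply: presented_coherent => x [t _ Wx]; have Ax := idxA Wx.
have [g _] := glue_iso Ax.
have [U [k [l [r [b [Ux pU]]]]]] :=
  coherent_presented (cF (idx x)) (WV Ax Wx).
have oUW : open (U `&` W t) by apply: openI => //; exact: pres_open pU.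
exists (U `&` W t), k, l, r, (fun x i => g x (b x i)); split=> //.
apply: presented_iso; first exact: presented_res pU.
  by move=> y [].
by move=> y [_ Wy]; exists t.
Qed.

End Glue.

(** * Extension from a closed subspace: near a point *)

Section Pullback.
Context (K : comNzRingType) (X Y : topologicalType) (O : algSheaf K X).
Context (f : Y -> X) (cf : continuous f).
Hypothesis f_induced : forall U, open U -> exists2 W, open W & U = f @^-1` W.

Lemma near_preimage y (P : Y -> Prop) : (\forall z \near y, P z) ->
  exists W, [/\ open W, W (f y) & forall z, W (f z) -> P z].
Proof.
move=> /near_open[U [/f_induced[W oW ->] Wy UP]].
by exists W.
Qed.

Lemma open_preimage (U : set X) : open U -> open (f @^-1` U).
Proof. by move=> oU; apply: open_comp => // z _; exact: cf. Qed.

Lemma pull_presented D (B : modSheaf O D) U k l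
    (r : forall x, 'M[O x]_(k, l)) (b : forall x, 'I_l -> B x) :
  presented U r b ->
  @presented K Y (pull_alg cf O) (f @^-1` D) (pull_mod cf B) (f @^-1` U) k l
    (fun y => r (f y)) (fun y => b (f y)).
Proof.
move=> [oU UD rU bU gU eU]; split.
- exact: open_preimage.
- by move=> y /UD.
- by move=> j i; exact: (pull_comp cf oU (@subsetT _ _) (rU j i)).
- by move=> i; exact: (pull_comp cf oU UD (bU i)).
- by move=> y Uy; exact: gU.
- by move=> y Uy; exact: eU.
Qed.

Lemma pull_coherent D (B : modSheaf O D) :
  coherent B -> coherent (pull_mod cf B).
Proof.
move=> cB; apply: presented_coherent => y Dy.
have [U [k [l [r [b [Uy /pull_presented pU]]]]]] := coherent_presented cB Dy.
by exists (f @^-1` U), k, l, (fun y => r (f y)), (fun y => b (f y)).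
Qed.

(** The images under phi of the generators of B1 near f y come from sections t_i
    of B2. The relations between the generators give sections of B2 that vanish
    at f y, hence near f y, so that the t_i define a homomorphism there. *)
Lemma hom_extend_local D1 D2 (B1 : modSheaf O D1) (B2 : modSheaf O D2) V
    (phi : modHom (f @^-1` V) (pull_mod cf B1) (pull_mod cf B2)) y :
  coherent B1 -> open V -> V `<=` D1 -> V `<=` D2 -> V (f y) ->
  exists W (Phi : modHom W B1 B2), [/\ open W, W (f y), W `<=` V &
    forall z, W (f z) -> Phi (f z) =1 phi z].
Proof.
move=> cB oV VD1 VD2 Vy.
have [U [k [l [r [b [Uy pU]]]]]] := coherent_presented cB (VD1 _ Vy).
have [oU UD rU bU gU eU] := pU.
have oUV : open (U `&` V) by exact: openI.
have /choice[t Ht] : forall i, exists t : forall x, B2 x,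
    (exists W, [/\ open W, W (f y), W `<=` D2 & msec B2 W t]) /\
    \forall z \near y, phi z (b (f z) i) = t (f z).
  move=> i.
  have pb : msec (pull_mod cf B1) (f @^-1` (U `&` V)) (fun z => b (f z) i).
    have UVD : U `&` V `<=` D1 by move=> z [/UD].
    have bUV : msec B1 (U `&` V) (fun x => b x i) by apply: sec_res (bU i).
    exact: (pull_comp cf oUV UVD bUV).
  have UVV : f @^-1` (U `&` V) `<=` f @^-1` V by move=> z [].
  have /(_ y (conj Uy Vy)) := hmap_sec phi (open_preimage oUV) UVV pb.
  by move=> [W [t [oW Wy WD tW pt]]]; exists t; split=> //; exists W.
(* W0 is a common neighbourhood on which all the t_i are sections, W1 one on
   which they induce the images of the generators. *)
have [W0 [oW0 W0y W0P]] :
    exists W, [/\ open W, W (f y) & forall x, W x -> forall i, exists W',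
      [/\ open W', W' x, W' `<=` D2 & msec B2 W' (t i)]].
  have : \forall x \near f y, forall i, exists W',
      [/\ open W', W' x, W' `<=` D2 & msec B2 W' (t i)].
    apply: filter_forall => i; have [[W [oW Wy WD tW]] _] := Ht i.
    by apply: filterS (open_near oW Wy) => x Wx; exists W.
  by move=> /near_open.
have tW0 P i : open P -> P `<=` W0 -> P `<=` D2 -> msec B2 P (t i).
  move=> oP PW PD; apply: sec_near => // x /PW/W0P/(_ i)[W' [oW' W'x W'D tW']].
  by exists W', (t i); split=> //; exact: nearW.
have [W1 [oW1 W1y W1P]] : exists W, [/\ open W, W (f y) &
    forall z, W (f z) -> forall i, phi z (b (f z) i) = t i (f z)].
  by apply: near_preimage; apply: filter_forall => i; have [] := Ht i.
pose t' x i := t i x.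
have oW : open (W0 `&` (U `&` V)) by exact: openI.
have WD2 : W0 `&` (U `&` V) `<=` D2 by move=> x [_ [_ /VD2]].
have : \forall x \near f y, forall j, lincomb (t' x) (row j (r x)) = 0.
  apply: filter_forall => j.
  apply: (msec_eq_near oW oW WD2 WD2) => //.
  - apply: msec_lincomb => //; first by move=> i; apply: tW0.
    move=> i; apply: sec_ext (sec_res _ _ _ _ (rU j i)) => //.
      by move=> x _; rewrite mxE.
    by move=> x [_ []].
  - exact: msec0.
  - have -> : lincomb (t' (f y)) (row j (r (f y))) =
        lincomb (fun i => phi y (b (f y) i)) (row j (r (f y))).
      by apply: eq_bigr => i _; rewrite W1P.
    have e : lincomb (b (f y)) (row j (r (f y))) = 0.
      by apply/eU => //; exists (delta_mx ord0 j); rewrite -rowE.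
    by rewrite -(@linear_lincomb _ _ _ _ _ (phi y)) /= e linear0.
move=> /(filterI (open_near oW (conj W0y (conj Uy Vy)))).
move=> /(filterI (open_near oW1 W1y))/near_open[W [oW' Wy WP]].
have WU : W `<=` U by move=> x /WP[_ [[_ []]]].
have WV : W `<=` V by move=> x /WP[_ [[_ []]]].
have WD2' : W `<=` D2 := subset_trans WV VD2.
have pW := presented_res oW' WU pU.
have [||Phi PhiE] := @hom_of_presented _ _ _ _ _ _ _ _ _ _ _ _ t' pW WD2'.
- by move=> i; apply: tW0 => // x /WP[_ [[]]].
- by move=> x /WP[_ []].
exists W, Phi; split=> // z Wz m.
have [a <-] := gU _ (WU _ Wz) m.
rewrite linear_lincomb (@linear_lincomb _ _ _ _ _ (phi z)).
apply: eq_bigr => i _; by rewrite PhiE // W1P //; have [] := WP _ Wz.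
Qed.

(** The relations of a presentation of B near y extend to sections of O near
    f y; take the module downstairs with these relations. *)
Lemma module_extend_local (B : modSheaf (pull_alg cf O) setT) y : coherent B ->
  exists W (F : modSheaf O W), [/\ open W, W (f y), coherent F &
    inhabited (modIso (f @^-1` W) (pull_mod cf F) B)].
Proof.
move=> cB.
have [U [k [l [r [b [Uy pU]]]]]] := coherent_presented cB (I : setT y).
have [oU UD rU bU gU eU] := pU.
have /choice[q Hq] : forall ji : 'I_k * 'I_l, exists q : forall x, O x,
    (exists W, [/\ open W, W (f y) & asec O W q]) /\
    \forall z \near y, (r z ji.1 ji.2 : O (f z)) = q (f z).
  move=> [j i]; have [W [q [oW Wy _ qW rq]]] := rU j i y Uy.
  by exists q; split=> //; exists W.
pose q' x : 'M[O x]_(k, l) := \matrix_(j, i) q (j, i) x.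
have : \forall x \near f y, forall ji,
    exists W', [/\ open W', W' x & asec O W' (q ji)].
  apply: filter_forall => ji; have [[W [oW Wy qW]] _] := Hq ji.
  by apply: filterS (open_near oW Wy) => x Wx; exists W.
have [W1 [oW1 W1y W1P]] : exists W, [/\ open W, W (f y) &
    forall z, W (f z) ->
      U z /\ forall ji, (r z ji.1 ji.2 : O (f z)) = q ji (f z)].
  apply: near_preimage; apply: filterI; first exact: open_near.
  by apply: filter_forall => ji; have [] := Hq ji.
move=> /(filterI (open_near oW1 W1y))/near_open[W [oW Wy WP]].
have q'W j i : asec O W (fun x => q' x j i).
  apply: sec_near => // x /WP[_ /(_ (j, i))[W' [oW' W'x qW']]].
  by exists W', (q (j, i)); split=> //; apply: nearW => z; rewrite mxE.
have WU z : W (f z) -> U z by move=> /WP[/W1P[]].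
have q'E z : W (f z) -> r z = q' (f z).
  by move=> /WP[/W1P[_ H] _]; apply/matrixP => j i; rewrite mxE -(H (j, i)).
have pF := coker_mod_presented oW q'W.
set F := coker_mod oW q'W in pF *.
have pF' := pull_presented pF.
set g := (fun x i => _) in pF.
have [//|||h hE] := @hom_of_presented _ _ _ _ _ _ B _ _ _ _ _ b pF'.
- move=> i; apply: sec_res (bU i) => //; exact: open_preimage.
- move=> z /= Wz j; apply/eU; first exact: WU.
  by exists (delta_mx ord0 j); rewrite q'E // -rowE.
have hL z : W (f z) -> forall a, h z (lincomb (g (f z)) a) = lincomb (b z) a.
  move=> Wz a; rewrite (@linear_lincomb _ _ _ _ _ (h z)); apply: eq_bigr => i _.
  by rewrite hE.
exists W, F; split=> //.
- apply: presented_coherent => x Wx.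
  by exists W, k, l, q', g.
- have [//|//|||e _] := @iso_of_bij _ _ _ _ _ _ _ _ h; last by split.
  + move=> z Wz m; have [a <-] := gU z (WU z Wz) m.
    by exists (lincomb (g (f z)) a); rewrite hL.
  + move=> z Wz m; have [a <-] := pres_gen pF Wz m.
    rewrite hL // => /eU[|c]; first exact: WU.
    by rewrite q'E // => ca; apply/(pres_rel pF) => //; exists c.
Qed.

(** * Extension from a closed subspace: globally *)

Hypotheses (hX : hausdorff_space X) (pX : paracompact X).

(** At q follow the local extension Phi_i for some i with q in K_i. Near a point
    f y with y in Z all the extensions in use agree, since they agree with phi
    at f y and are finite in number; so the result is locally one of the
    Phi_i. *)
Lemma hom_extend D1 D2 (B1 : modSheaf O D1) (B2 : modSheaf O D2) (Z : set Y)
    (phi : forall y, B1 (f y) -> B2 (f y)) :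
  coherent B1 -> closed (f @` Z) ->
  (forall y, Z y -> exists W (Phi : modHom W B1 B2),
    [/\ open W, W (f y), W `<=` D1 `&` D2 &
     forall z, Z z -> W (f z) -> Phi (f z) =1 phi z]) ->
  exists P (Phi : modHom P B1 B2),
    [/\ open P, f @` Z `<=` P, P `<=` D1 `&` D2 &
     forall y, Z y -> Phi (f y) =1 phi y].
Proof.
move=> cB cZ H.
have H' (i : {y | Z y}) : exists WPhi : {W & modHom W B1 B2},
    [/\ open (projT1 WPhi), projT1 WPhi (f (sval i)),
    projT1 WPhi `<=` D1 `&` D2 &
     forall z, Z z -> projT1 WPhi (f z) -> projT2 WPhi (f z) =1 phi z].
  have [W [Phi [? ? ? ?]]] := H _ (proj2_sig i).
  by exists (existT _ W Phi).
have [G GP] := choice H'.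
pose V i := projT1 (G i).
pose Phi i : modHom (V i) B1 B2 := projT2 (G i).
have oV i : open (V i) by have [] := GP i.
have VD i : V i `<=` D1 `&` D2 by have [] := GP i.
have PhiE i z : Z z -> V i (f z) -> Phi i (f z) =1 phi z.
  by have [_ _ _] := GP i; apply.
have [|K' [KV Kfin Kusc Kcov]] := paracompact_shrinking hX pX cZ oV.
  by move=> _ [y Zy <-]; exists (exist _ y Zy); have [] := GP (exist _ y Zy).
pose Psi q : {linear B1 q -> B2 q} :=
  if pselect (exists i, K' i q) is left e then Phi (projT1 (cid e)) q else \0.
(* P is the largest open set on which Psi is locally one of the Phi_i. *)
pose good i (W : set X) :=
  [/\ open W, W `<=` V i & forall q, W q -> Psi q =1 Phi i q].
pose P := \bigcup_(W in [set W | exists i, good i W]) W.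
have oP : open P by apply: bigcup_open => W [i []].
have PD : P `<=` D1 `&` D2 by move=> q [W [i [_ WV _]] /WV/VD].
have hsec U s : open U -> U `<=` P -> msec B1 U s ->
    msec B2 U (fun x => Psi x (s x)).
  move=> oU UP sU; apply: sec_near => //; first by move=> q /UP/PD[].
  move=> x Ux; have [W [i [oW WV WE]] Wx] := UP _ Ux.
  have oUW : open (U `&` W) by exact: openI.
  exists (U `&` W), (fun x => Phi i x (s x)); split=> //.
  - by move=> q [/UP/PD[]].
  - apply: (hmap_sec (Phi i) oUW); first by move=> q [_ /WV].
    by apply: sec_res sU => // q /UP/PD[].
  - by apply: filterS (open_near oW Wx) => q Wq; rewrite WE.
have agree y i : Z y -> K' i (f y) -> Phi i (f y) =1 phi y.
  by move=> Zy Ki; apply: PhiE => //; exact: KV.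
have PsiE y : Z y -> Psi (f y) =1 phi y.
  move=> Zy; have e : exists i, K' i (f y).
    by apply: nbhs_singleton (Kcov _ _); exists y.
  rewrite /Psi; case: pselect => // e'; apply: agree => //.
  exact: (projT2 (cid e')).
exists P, (ModHom hsec); split=> //.
move=> _ [y Zy <-].
have Zfy : (f @` Z) (f y) by exists y.
have [i0 Ki0] : exists i, K' i (f y) := nbhs_singleton (Kcov _ Zfy).
have : \forall q \near f y, forall i, K' i (f y) -> Phi i q =1 Phi i0 q.
  apply: near_finite (Kfin (f y)) _ => i Ki.
  have [Vi Vi0] := (KV _ _ Ki, KV _ _ Ki0).
  apply: (hom_eq_near cB) => //.
  - by have [] := VD _ _ Vi.
  - by move=> q /VD[].
  - by move=> q /VD[].
  - by move=> m; rewrite !agree.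
move=> /(filterI (Kusc (f y)))/(filterI (Kcov _ Zfy)).
move=> /(filterI (open_near (oV i0) (KV _ _ Ki0))).
move=> /near_open[W [oW Wy WP]]; exists W => //; exists i0; split=> //.
  by move=> q /WP[].
move=> q /WP[_ [e [Kq Pq]]] m; rewrite /Psi; case: pselect => // e'.
by apply: Pq; apply: Kq; exact: (projT2 (cid e')).
Qed.

End Pullback.

Section Extension.
Context (K : comNzRingType) (X Y : topologicalType) (O : algSheaf K X).
Context (f : Y -> X) (cf : continuous f).
Hypothesis f_induced : forall U, open U -> exists2 W, open W & U = f @^-1` W.
Hypotheses (hX : hausdorff_space X) (pX : paracompact X).

Lemma hom_extend_closed D1 D2 (B1 : modSheaf O D1) (B2 : modSheaf O D2) V
    (phi : modHom (f @^-1` V) (pull_mod cf B1) (pull_mod cf B2)) (Z : set Y) :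
  coherent B1 -> open V -> V `<=` D1 -> V `<=` D2 ->
  closed (f @` Z) -> f @` Z `<=` V ->
  exists P (Phi : modHom P B1 B2),
    [/\ open P, f @` Z `<=` P, P `<=` D1 `&` D2 &
     forall y, Z y -> Phi (f y) =1 phi y].
Proof.
move=> cB oV VD1 VD2 cZ ZV.
apply: (hom_extend hX pX
  (phi := fun y => phi y : B1 (f y) -> B2 (f y))) => // y Zy.
have Vy : V (f y) by apply: ZV; exists y.
have [W [Phi [oW Wy WV WE]]] := hom_extend_local f_induced phi cB oV VD1 VD2 Vy.
exists W, Phi; split=> //.
  by move=> x /WV Vx; split; [exact: VD1 | exact: VD2].
by move=> z _ Wz; exact: WE.
Qed.

Lemma hom_unique D1 D2 (B1 : modSheaf O D1) (B2 : modSheaf O D2) P Q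
    (Phi : modHom P B1 B2) (Psi : modHom Q B1 B2) :
  coherent B1 -> open P -> open Q -> P `<=` D1 -> P `<=` D2 -> Q `<=` D2 ->
  range f `<=` P -> range f `<=` Q ->
  (forall y, Phi (f y) =1 Psi (f y)) ->
  exists W, [/\ open W, range f `<=` W, W `<=` P `&` Q & hom_eq W Phi Psi].
Proof.
move=> cB oP oQ PD1 PD2 QD2 fP fQ e.
exists [set x | P x /\ Q x /\ Phi x =1 Psi x]°; split.
- exact: open_interior.
- move=> _ [y _ <-].
  have Py : P (f y) by apply: fP; exists y.
  have Qy : Q (f y) by apply: fQ; exists y.
  have := hom_eq_near cB (PD1 _ Py) PD2 QD2 oP oQ Py Qy (e y).
  move=> /(filterI (open_near oQ Qy))/(filterI (open_near oP Py)).
  by apply: filterS => x [? []].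
- by move=> x /interior_subset[? []].
- by move=> x /interior_subset[_ []].
Qed.

Hypothesis f_closed : closed (range f).

(** Extend phi and psi separately; the composites of the extensions are the
    identity at the points of Y, hence near them. *)
Lemma iso_extend N (B1 B2 : modSheaf O N)
    (phi : modHom setT (pull_mod cf B1) (pull_mod cf B2))
    (psi : modHom setT (pull_mod cf B2) (pull_mod cf B1)) :
  open N -> range f `<=` N -> coherent B1 -> coherent B2 ->
  (forall y, cancel (phi y) (psi y)) -> (forall y, cancel (psi y) (phi y)) ->
  exists P (Phi : modIso P B1 B2),
    [/\ open P, P `<=` N, range f `<=` P & forall y, Phi (f y) =1 phi y].
Proof.
move=> oN fN c1 c2 phiK psiK.
have [P [Phi [oP fP PN PhiE]]] := hom_extend_closed
  (hom_res (@subsetT _ _) phi) c1 oN (@subset_refl _ _)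
  (@subset_refl _ _) f_closed fN.
have [Q [Psi [oQ fQ QN PsiE]]] := hom_extend_closed
  (hom_res (@subsetT _ _) psi) c2 oN (@subset_refl _ _)
  (@subset_refl _ _) f_closed fN.
have oPQ : open (P `&` Q) by exact: openI.
have PQN : P `&` Q `<=` N by move=> x [/PN[]].
have fPQ : range f `<=` P `&` Q by move=> x fx; split; [exact: fP | exact: fQ].
pose Phi1 := hom_res (@subIsetl _ P Q) Phi.
pose Psi1 := hom_res (@subIsetr _ P Q) Psi.
have [W1 [oW1 fW1 W1PQ W1E]] := @hom_unique _ _ _ _ _ _ (hom_comp Psi1 Phi1)
  (hom_id (P `&` Q) B1) c1 oPQ oPQ PQN PQN PQN fPQ fPQ
  (fun y a => etrans (congr1 (Psi (f y)) (PhiE y I a))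
     (etrans (PsiE y I _) (phiK y a))).
have [W2 [oW2 fW2 W2PQ W2E]] := @hom_unique _ _ _ _ _ _ (hom_comp Phi1 Psi1)
  (hom_id (P `&` Q) B2) c2 oPQ oPQ PQN PQN PQN fPQ fPQ
  (fun y a => etrans (congr1 (Phi (f y)) (PsiE y I a))
     (etrans (PhiE y I _) (psiK y a))).
have WP : W1 `&` W2 `<=` P by move=> x [/W1PQ[[]]].
have WQ : W1 `&` W2 `<=` Q by move=> x [/W1PQ[[]]].
exists (W1 `&` W2),
  (ModIso (iso_hom := hom_res WP Phi) (iso_inv := hom_res WQ Psi)
     (fun x Wx => W1E x Wx.1) (fun x Wx => W2E x Wx.2)); split.
- exact: openI.
- by move=> x /WP/PN[].
- by move=> x fx; split; [exact: fW1 | exact: fW2].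
- by move=> y a; exact: PhiE.
Qed.

(** The local extensions F_i are indexed by the points i of Y around which they
    are defined. They are glued along extensions Phi_ij of the isomorphisms
    phi_ij that B induces between their inverse images; each phi_ij is extended
    only from the points of K_i and K_j, which form a closed set, and this is
    enough since F_i is used at q only if q is in K_i. *)
Lemma module_extend (B : modSheaf (pull_alg cf O) setT) : coherent B ->
  exists N, [/\ open N, range f `<=` N & exists B' : modSheaf O N,
    coherent B' /\ inhabited (modIso setT (pull_mod cf B') B)].
Proof.
move=> cB; have [noY|/existsNP[y0 _]] := pselect (Y -> False).
  (* Without a point of Y there is no index to choose at each point of X below;
     the empty neighbourhood does. *)
  have r0 (j i : 'I_0) : asec O set0 (fun x => (0 : 'M[O x]_0) j i) by case: j.
  pose F0 := coker_mod (@open0 X) r0.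
  exists set0; split; [exact: open0 | by move=> x [y] |].
  exists F0; split; first by [].
  pose h y : {linear pull_mod cf F0 y -> B y} := \0.
  have hsec U s : open U -> U `<=` setT -> msec (pull_mod cf F0) U s ->
      msec B U (fun x => h x (s x)).
    by move=> oU _ _; apply: sec_near => // y; case: (noY y).
  have [||||g _] := @iso_of_bij _ _ _ _ _ _ _ setT (ModHom hsec); last by split.
  1-4: by move=> y; case: (noY y).
have H y : exists G : {V : set X & {F : modSheaf O V &
    modIso (f @^-1` V) (pull_mod cf F) B}},
    [/\ open (projT1 G), projT1 G (f y) & coherent (projT1 (projT2 G))].
  have [V [F [oV Vy cF [psi]]]] := module_extend_local f_induced y cB.
  by exists (existT _ V (existT _ F psi)).
have [G GP] := choice H.
pose V i := projT1 (G i).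
pose F i : modSheaf O (V i) := projT1 (projT2 (G i)).
pose psi i : modIso (f @^-1` V i) (pull_mod cf (F i)) B :=
  projT2 (projT2 (G i)).
have oV i : open (V i) by have [] := GP i.
have Vi i : V i (f i) by have [] := GP i.
have cF i : coherent (F i) by have [] := GP i.
have [|K' [KV Kfin Kusc Kcov]] := paracompact_shrinking hX pX f_closed oV.
  by move=> _ [y _ <-]; exists y.
have oVV i j : open (V i `&` V j) by exact: openI.
have VVl i j : f @^-1` (V i `&` V j) `<=` f @^-1` V i by move=> y [].
have VVr i j : f @^-1` (V i `&` V j) `<=` f @^-1` V j by move=> y [].
pose phi i j : modHom (f @^-1` (V i `&` V j)) (pull_mod cf (F i))
    (pull_mod cf (F j)) :=
  hom_comp (hom_res (VVr i j) (iso_inv (psi j)))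
    (hom_res (VVl i j) (iso_hom (psi i))).
have phiE i j y : V j (f y) -> forall a, psi j y (phi i j y a) = psi i y a.
  by move=> Vj a; exact: (iso_invK (psi j)).
have psi_inj i y : V i (f y) -> injective (psi i y).
  by move=> Vy; exact: can_inj (iso_homK (psi i) Vy).
(* As no K_i other than those through p occurs near p, the complement of K_i is
   open. *)
have cK i : closed (K' i).
  rewrite -(setCK (K' i)); apply: open_closedC; rewrite openE => p nKp.
  by apply: filterS (Kusc p) => q H' Kq; apply: nKp; exact: H'.
pose Z i j := [set y | K' i (f y) /\ K' j (f y)].
have cZ i j : closed (f @` Z i j).
  have -> : f @` Z i j = range f `&` (K' i `&` K' j).
    apply/seteqP; split=> [_ [y Zy <-]|_ [[y _ <-] Ky]]; last by exists y.
    by split=> //; exists y.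
  by apply: closedI => //; exact: closedI.
have ZV i j : f @` Z i j `<=` V i `&` V j.
  by move=> _ [y [Ki Kj] <-]; split; exact: KV.
have E i j := hom_extend_closed (phi i j) (cF i) (oVV i j) (@subIsetl _ _ _)
  (@subIsetr _ _ _) (cZ i j) (ZV i j).
pose P i j := projT1 (cid (E i j)).
pose Phi i j : modHom (P i j) (F i) (F j) :=
  projT1 (cid (projT2 (cid (E i j)))).
have EP i j : [/\ open (P i j), f @` Z i j `<=` P i j, P i j `<=` V i `&` V j &
     forall y, Z i j y -> Phi i j (f y) =1 phi i j y].
  exact: (projT2 (cid (projT2 (cid (E i j))))).
have oP i j : open (P i j) by have [] := EP i j.
have PVl i j : P i j `<=` V i by move=> x; have [_ _ H' _] := EP i j => /H'[].
have PVr i j : P i j `<=` V j by move=> x; have [_ _ H' _] := EP i j => /H'[].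
have PZ i j y : K' i (f y) -> K' j (f y) -> P i j (f y).
  by move=> Ki Kj; have [_ H' _ _] := EP i j; apply: H'; exists y.
have PhiZ i j y : K' i (f y) -> K' j (f y) -> Phi i j (f y) =1 phi i j y.
  by move=> Ki Kj; have [_ _ _] := EP i j; apply.
have PhipsiZ i j y a : K' i (f y) -> K' j (f y) ->
    psi j y (Phi i j (f y) a) = psi i y a.
  by move=> Ki Kj; rewrite PhiZ // phiE //; exact: KV.
(* The following properties hold at f y for the finitely many indices i with
   f y in K_i, hence near f y (or near y) for all of these at once. *)
have near2 y : \forall q \near f y, forall i, K' i (f y) ->
    forall j, K' j (f y) -> P i j q.
  apply: (near_finite (Kfin (f y))) => i Ki.
  apply: (near_finite (Kfin (f y))) => j Kj.
  by apply: open_near => //; exact: PZ.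
have near1 y : \forall q \near f y, forall i, K' i (f y) ->
    forall a, Phi i i q a = a.
  apply: (near_finite (Kfin (f y))) => i Ki; have Piy := PZ _ _ _ Ki Ki.
  apply: (hom_eq_near (g := hom_id (P i i) (F i)) (cF i) _
    (@PVl i i) (@PVl i i)) => //.
    exact: KV.
  by move=> a; apply: (psi_inj i y); [exact: KV | rewrite PhipsiZ].
have near3 y : \forall q \near f y, forall i, K' i (f y) ->
    forall j, K' j (f y) -> forall k, K' k (f y) ->
    forall a, Phi j k q (Phi i j q a) = Phi i k q a.
  apply: (near_finite (Kfin (f y))) => i Ki.
  apply: (near_finite (Kfin (f y))) => j Kj.
  apply: (near_finite (Kfin (f y))) => k Kk.
  pose comp := hom_comp (hom_res (@subIsetr _ (P i j) (P j k)) (Phi j k))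
    (hom_res (@subIsetl _ (P i j) (P j k)) (Phi i j)).
  apply: (hom_eq_near (f := comp) (g := Phi i k) (cF i)) => //.
  - exact: KV.
  - by move=> q [_ /PVr].
  - exact: openI.
  - by split; exact: PZ.
  - exact: PZ.
  - by move=> a; apply: (psi_inj k y); [exact: KV | rewrite /= !PhipsiZ].
have nearY y : \forall z \near y, forall i, K' i (f y) ->
    forall j, K' j (f y) -> Phi i j (f z) =1 phi i j z.
  apply: (near_finite (A := [set i | K' i (f y)]) (Kfin (f y))) => i Ki.
  apply: (near_finite (A := [set i | K' i (f y)]) (Kfin (f y))) => j Kj.
  apply: (hom_eq_near (f := pull_hom cf (oP i j) (@PVr i j) (Phi i j))
    (g := phi i j) (pull_coherent cf (cF i))) => //.
  - exact: KV.
  - by move=> z /PVr.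
  - exact: open_preimage.
  - exact: open_preimage.
  - exact: PZ.
  - by split; exact: KV.
  - exact: PhiZ.
have /choice[W WP] y : exists W, [/\ open W, W (f y),
    forall z, W (f z) -> forall i, K' i (f y) -> forall j, K' j (f y) ->
      Phi i j (f z) =1 phi i j z &
    forall q, W q ->
      [/\ exists i, K' i q,
        forall i, K' i q -> K' i (f y),
        forall i, K' i (f y) -> forall j, K' j (f y) -> P i j q,
        forall i, K' i (f y) -> forall a, Phi i i q a = a &
        forall i, K' i (f y) -> forall j, K' j (f y) -> forall k, K' k (f y) ->
          forall a, Phi j k q (Phi i j q a) = Phi i k q a]].
  have [W1 [oW1 W1y W1P]] := near_preimage f_induced (nearY y).
  have Ky : \forall q \near f y, exists i, K' i q by apply: Kcov; exists y.
  have [W [oW Wy WP]] := near_open (filterI (open_near oW1 W1y)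
    (filterI (filterI Ky (Kusc (f y)))
       (filterI (near1 y) (filterI (near2 y) (near3 y))))).
  exists W; split=> // [z /WP[W1z _]|q /WP[_ [[? ?] [? []]]]//]; exact: W1P.
pose idx q :=
  if pselect (exists i, K' i q) is left e then projT1 (cid e) else y0.
have oW y : open (W y) by have [] := WP y.
have idxA y q : W y q -> K' (idx q) (f y).
  have [_ _ _ H'] := WP y => /H'[e Ke _ _ _]; apply: Ke.
  by rewrite /idx; case: pselect => // e'; exact: (projT2 (cid e')).
have WV y i : K' i (f y) -> W y `<=` V i.
  have [_ _ _ H'] := WP y => Ki q /H'[_ _ Pq _ _].
  exact: PVl (Pq i Ki i Ki).
have Phi_sec y i j U s : K' i (f y) -> K' j (f y) -> open U -> U `<=` W y ->
    msec (F i) U s -> msec (F j) U (fun x => Phi i j x (s x)).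
  move=> Ki Kj oU UW; apply: hmap_sec => // q /UW.
  by have [_ _ _ H'] := WP y => /H'[_ _ Pq _ _]; exact: Pq.
have Phi_comp y i j k q : K' i (f y) -> K' j (f y) -> K' k (f y) -> W y q ->
    forall a, Phi j k q (Phi i j q a) = Phi i k q a.
  by have [_ _ _ H'] := WP y => Ki Kj Kk /H'[_ _ _ _ Pq]; exact: Pq.
have Phi_id y i q : K' i (f y) -> W y q -> forall a, Phi i i q a = a.
  by have [_ _ _ H'] := WP y => Ki /H'[_ _ _ Pq _]; exact: Pq.
have cG := glue_coherent oW WV idxA Phi_sec Phi_comp Phi_id cF.
set B' := glue_mod oW WV idxA Phi_sec Phi_comp Phi_id in cG.
have Wy y : W y (f y) by have [] := WP y.
have fN : range f `<=` \bigcup_y W y by move=> _ [y _ <-]; exists y.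
exists (\bigcup_y W y); split=> //; first by apply: bigcup_open.
exists B'; split=> //.
pose h y : {linear pull_mod cf B' y -> B y} := psi (idx (f y)) y.
have Vidx y : V (idx (f y)) (f y) by exact: WV (idxA _ _ (Wy y)) _ (Wy y).
(* Near y a section of B' comes from a section s0 of F_i with i = idx (f y), and
   there the psi_j with j = idx (f z) maps it to the image of s0 under psi_i,
   since Phi_ij extends phi_ij not only at y but near y. *)
have hsec U s : open U -> U `<=` setT -> msec (pull_mod cf B') U s ->
    msec B U (fun y => h y (s y)).
  move=> oU _ sU; apply: sec_near => // y Uy.
  have [Q [t [oQ Qy _ tQ st]]] := sU y Uy.
  have Ky := idxA _ _ (Wy y); set i := idx (f y) in Ky *.
  have [Q' [oQ' Q'y Q'W [s0 s0Q ts0]]] :=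
    glue_rechart oW WV idxA Phi_sec Phi_comp (tQ _ Qy) (Wy y) Ky.
  have Q'V : Q' `<=` V i := subset_trans Q'W (WV _ _ Ky).
  exists (f @^-1` Q'), (fun z => psi i z (s0 (f z))); split=> //.
  - exact: open_preimage.
  - apply: (hmap_sec (psi i)) => //; first exact: open_preimage.
      by move=> z /Q'V.
    exact: pull_comp.
  - have Q'z := open_near (open_preimage cf oQ') Q'y.
    apply: filterS2 st Q'z => z -> Q'z; rewrite ts0 //.
    have Wz := Q'W _ Q'z; have [_ _ H' _] := WP y.
    rewrite /h (H' z Wz i Ky _ (idxA _ _ Wz)); exact: phiE.
have [|//|||g _] := @iso_of_bij _ _ _ _ _ _ _ setT (ModHom hsec); last by split.
- by move=> y _; apply: fN; exists y.
- move=> y _ b; exists (iso_inv (psi (idx (f y))) y b).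
  exact: (iso_invK (psi (idx (f y))) (Vidx y) b).
- by move=> y _ a; rewrite /= -(linear0 (h y)) => /(psi_inj _ _ (Vidx y)).
Qed.

End Extension.

Theorem theorem2 (R : realType) (M M' : complexManifold R) (iota : M -> M')
    (emb : closed_embedding iota) :
  let ci := embedding_continuous emb in
  let A := pull_alg ci (holo M') in
  forall (B : modSheaf A setT) (cohB : coherent B),
  (exists N : set M', [/\ open N, range iota `<=` N &
     exists B' : modSheaf (holo M') N, coherent B' /\
       inhabited (modIso setT (pull_mod ci B') B)]) /\
  (forall (N : set M') (oN : open N) (MN : range iota `<=` N)
     (B1 B2 : modSheaf (holo M') N) (coh1 : coherent B1) (coh2 : coherent B2)
     (b1 : modIso setT (pull_mod ci B1) B) (b2 : modIso setT (pull_mod ci B2) B),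
   let phi := hom_comp (iso_inv b2) (iso_hom b1) in
   (exists (P : set M') (oP : open P) (PN : P `<=` N), range iota `<=` P /\
      exists Phi : modIso P B1 B2,
        hom_eq setT (pull_hom ci oP PN (iso_hom Phi)) phi) /\
   (forall (P P' : set M') (oP : open P) (oP' : open P')
      (PN : P `<=` N) (PN' : P' `<=` N)
      (MP : range iota `<=` P) (MP' : range iota `<=` P')
      (Phi : modHom P B1 B2) (Phi' : modHom P' B1 B2),
      hom_eq setT (pull_hom ci oP PN Phi) phi ->
      hom_eq setT (pull_hom ci oP' PN' Phi') phi ->
      exists Q : set M', [/\ open Q, range iota `<=` Q, Q `<=` P `&` P' &
        hom_eq Q Phi Phi'])).
Proof.
move=> ci A B cB.
have hX := @manifold_hausdorff _ M'; have pX := @manifold_paracompact _ M'.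
have f_ind := embedding_homeo_range emb.
have f_cl := embedding_closed_range emb.
split; first exact: module_extend.
move=> N oN MN B1 B2 c1 c2 b1 b2 phi; split.
  pose psi := hom_comp (iso_inv b1) (iso_hom b2).
  have phiK y : cancel (phi y) (psi y).
    move=> a; rewrite /= (iso_invK b2) //; exact: (iso_homK b1).
  have psiK y : cancel (psi y) (phi y).
    move=> a; rewrite /= (iso_invK b1) //; exact: (iso_homK b2).
  have [P [Phi [oP PN MP PhiE]]] :=
    iso_extend f_ind hX pX f_cl oN MN c1 c2 phiK psiK.
  by exists P, oP, PN; split=> //; exists Phi => y _; exact: PhiE.
move=> P P' oP oP' PN PN' MP MP' Phi Phi' PhiE PhiE'.
apply: hom_unique => // y a.
exact: etrans (PhiE y I a) (esym (PhiE' y I a)).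
Qed.
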